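(* Let $q$ be a prime power, $u\in\mathbb{F}_q^\times$, and let $X_u$ be the surface over $\mathbb{F}_q$ in $\mathbb{P}^3$ defined by $y_1^4+y_2^4+y_3^4+y_4^4-4u^{-1}y_1y_2y_3y_4=0$. (1) If $q\equiv3\pmod4$, then $$\#X_u(\mathbb{F}_q)=q^2+q+1+F_q\big((\tfrac14,\tfrac24,\tfrac34)\,;(1,1,1)\mid u^4\big)-3q\,F_q\big((\tfrac14,\tfrac34)\,;(\tfrac12,1)\mid u^4\big).$$ (2) If $q\equiv1\pmod4$, then $$\#X_u(\mathbb{F}_q)=q^2+q+1+F_q\big((\tfrac14,\tfrac24,\tfrac34)\,;(1,1,1)\mid u^4\big)+3q\,F_q\big((\tfrac14,\tfrac34)\,;(\tfrac12,1)\mid u^4\big)+12\,\chi(-1)^{(q-1)/4}\,q\,F_q\big((\tfrac12)\,;(1)\mid u^4\big).$$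
   Context: Put $q^\times=q-1$. Fix a non-trivial additive character $\psi:\mathbb{F}_q\to\mathbb{C}^\times$ and a multiplicative character $\chi:\mathbb{F}_q^\times\to\mathbb{C}^\times$ of order $q^\times$; $\chi^m(x)=\chi(x)^m$, $\zeta_k=e^{2\pi i/k}$. The Gauss sum is $g(m)=\sum_{u\in\mathbb{F}_q^\times}\psi(u)\chi^m(u)$, and $g(v)=\prod_ig(v_i)$ for an integer vector $v$. Hypergeometric parameters $(\alpha\,;\beta)$ are vectors $\alpha,\beta\in\mathbb{Q}^n$ ($n\ge0$) with $\alpha_i-\beta_j\notin\mathbb{Z}$ for all $i,j$. If $q^\times\alpha,q^\times\beta\in\mathbb{Z}^n$, then for $t\in\mathbb{F}_q^\times$ $$F_q(\alpha\,;\beta\mid t)=\frac{1}{1-q}\sum_{m=0}^{q^\times-1}\prod_{i=1}^n\frac{g(m+\alpha_iq^\times)\,g(-m-\beta_iq^\times)}{g(\alpha_iq^\times)\,g(-\beta_iq^\times)}\;\chi((-1)^nt)^m.$$ Extension to other $q$: a gamma triple $(\gamma,\delta,N)$ consists of $\gamma\in\mathbb{Z}^{d+2}$ with all components non-zero, $\sum_j\gamma_j=0$, $\gcd_j(\gamma_j)=1$; a vector $\delta\in\mathbb{Z}^{d+2}$; and a positive integer $N$. It represents $(\alpha\,;\beta)$ if $\prod_j(T-e^{2\pi i\alpha_j})/\prod_j(T-e^{2\pi i\beta_j})=\prod_{\gamma_j<0}(T^{-\gamma_j}-\zeta_N^{\delta_j})/\prod_{\gamma_j>0}(T^{\gamma_j}-\zeta_N^{-\delta_j})$.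 Let $s_\delta(m)$ be the multiplicity of $e^{2\pi im/q^\times}$ as a zero of the greatest common divisor of the numerator and denominator of the latter quotient. If $q$ is coprime to all $\gamma_j$ and $N\mid q^\times$, set $$F_q(\gamma,\delta,N\mid t)=\frac{1}{1-q}\sum_{m=0}^{q^\times-1}\frac{g\left(-\gamma m+\frac{\delta}{N}q^\times\right)}{g\left(\frac{\delta}{N}q^\times\right)}\,q^{s_\delta(-m)-s_\delta(0)}\,\chi^m(\gamma^\gamma t),\qquad\gamma^\gamma=\prod_j\gamma_j^{\gamma_j}.$$ Then $F_q(\alpha\,;\beta\mid t)$ is by definition $F_q(\gamma,\delta,N\mid t)$ for any gamma triple representing $(\alpha\,;\beta)$ which is defined at $q$ (this is independent of the triple and agrees with the first formula when $q^\times\alpha,q^\times\beta$ are integral). For example, with $\gamma=(-4,1,1,1,1)$, the triples $(\gamma,(0,0,0,0,0),1)$ and $(\gamma,(0,1,1,0,0),2)$ represent $((\tfrac14,\tfrac24,\tfrac34)\,;(1,1,1))$ and $((\tfrac14,\tfrac34)\,;(\tfrac12,1))$ respectively. *)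

(* Defs.v *)
From mathcomp Require Import all_boot all_order all_algebra.
From mathcomp Require Import complex.
From mathcomp Require Import boolp classical_sets reals trigo.

Set Implicit Arguments.
Unset Strict Implicit.
Unset Printing Implicit Defensive.

Import Order.TTheory GRing.Theory Num.Theory.

Local Open Scope ring_scope.

(* [expi2pi R x] is e^(2 pi i x); the complex numbers are R[i]. *)
Definition expi2pi (R : realType) (x : rat) : R[i] :=
  Complex (cos (2 * pi * ratr x)) (sin (2 * pi * ratr x)).

Definition zeta (R : realType) (k : nat) : R[i] := expi2pi R (k%:R)^-1.

Record hyp_param (n : nat) := HypParam {
  hp_alpha : n.-tuple rat;
  hp_beta : n.-tuple rat;
  hp_disjoint :
    all (fun a => all (fun b => a - b \isn't a Num.int) hp_beta) hp_alpha
}.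

Record gamma_triple := GammaTriple {
  gt_dim : nat;
  gt_gamma : gt_dim.+2.-tuple int;
  gt_delta : gt_dim.+2.-tuple int;
  gt_N : nat;
  gt_gamma_neq0 : forall j, tnth gt_gamma j != 0;
  gt_gamma_sum0 : \sum_j tnth gt_gamma j = 0;
  gt_gamma_gcd1 : \big[gcdn/0%N]_j `|tnth gt_gamma j|%N = 1%N;
  gt_N_gt0 : (0 < gt_N)%N
}.

Section GammaTripleTheory.
Variables (R : realType) (G : gamma_triple).
Let gam := tnth (gt_gamma G).
Let del := tnth (gt_delta G).

Definition gt_num : {poly R[i]} :=
  \prod_(j | gam j < 0) ('X^(`|gam j|%N) - (zeta R (gt_N G) ^ del j)%:P).

Definition gt_den : {poly R[i]} :=
  \prod_(j | 0 < gam j) ('X^(`|gam j|%N) - (zeta R (gt_N G) ^ (- del j))%:P).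

Definition represents (n : nat) (P : hyp_param n) : Prop :=
  tofrac (\prod_j ('X - (expi2pi R (tnth (hp_alpha P) j))%:P))
    / tofrac (\prod_j ('X - (expi2pi R (tnth (hp_beta P) j))%:P))
  = tofrac gt_num / tofrac gt_den :> {fraction {poly R[i]}}.

Definition s_delta (q : nat) (m : int) : nat :=
  mup (expi2pi R (m%:~R / (q.-1)%:R)) (gcdp gt_num gt_den).

Definition defined_at (q : nat) : bool :=
  [forall j, coprime q `|gam j|%N] && (gt_N G %| q.-1)%N.

End GammaTripleTheory.

Section Characters.
Variables (R : realType) (F : finFieldType).

Definition nontrivial_additive_character (psi : F -> R[i]) : Prop :=
  [/\ forall x, psi x != 0,
      forall x y, psi (x + y) = psi x * psi y
    & exists x, psi x != 1].

(* Characters of the group of nonzero elements: the value at 0 is never used. *)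
Definition multiplicative_character (chi : F -> R[i]) : Prop :=
  (forall x, x != 0 -> chi x != 0) /\
  (forall x y, x != 0 -> y != 0 -> chi (x * y) = chi x * chi y).

Definition character_order (chi : F -> R[i]) (k : nat) : Prop :=
  [/\ (0 < k)%N,
      forall x, x != 0 -> chi x ^+ k = 1
    & forall m : nat, (0 < m < k)%N -> exists2 x, x != 0 & chi x ^+ m != 1].

End Characters.

Section HypergeometricSums.
Variables (R : realType) (F : finFieldType) (psi chi : F -> R[i]).

Let q : nat := #|F|.
Let q1 : nat := q.-1.

Definition gauss (m : int) : R[i] := \sum_(u : F | u != 0) psi u * chi u ^ m.

(* The rational number x (q - 1) as an integer, when it is one. *)
Definition scaled (x : rat) : int := Num.floor (x * q1%:R).

Definition integral_at (n : nat) (P : hyp_param n) : bool :=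
  all (fun x : rat => x * q1%:R \is a Num.int) (hp_alpha P) &&
  all (fun x : rat => x * q1%:R \is a Num.int) (hp_beta P).

Definition Fq_integral (n : nat) (P : hyp_param n) (t : F) : R[i] :=
  (1 - q%:R)^-1 *
  \sum_(m < q1)
    (\prod_(i < n)
       let a := scaled (tnth (hp_alpha P) i) in
       let b := scaled (tnth (hp_beta P) i) in
       (gauss (m%:Z + a) * gauss (- m%:Z - b)) / (gauss a * gauss (- b)))
    * chi ((-1) ^+ n * t) ^+ m.

Definition Fq_gamma (G : gamma_triple) (t : F) : R[i] :=
  let gam := tnth (gt_gamma G) in
  (* delta_j (q - 1) / N, an integer as N divides q - 1 *)
  let del j := tnth (gt_delta G) j * (q1 %/ gt_N G)%N%:Z in
  let s m : int := (s_delta R G q m)%:Z in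
  (1 - q%:R)^-1 *
  \sum_(m < q1)
    (\prod_j gauss (- gam j * m%:Z + del j)) / (\prod_j gauss (del j))
    * q%:R ^ (s (- m%:Z) - s 0)
    * chi ((\prod_j ((gam j)%:~R : F) ^ gam j) * t) ^+ m.

Definition represents_at (n : nat) (P : hyp_param n) (G : gamma_triple) : Prop :=
  represents R G P /\ defined_at G q.

(* Outside the integral case, F_q(alpha ; beta | t) is the value Fq_gamma G t
   of any gamma triple G that represents (alpha ; beta) and is defined at q.
   This value does not depend on G, so any choice of G gives the same function;
   G is chosen here among the triples with the smallest N. The value 0 is a
   placeholder for the parameters that have no such triple. *)
Definition Fq (n : nat) (P : hyp_param n) (t : F) : R[i] :=
  if integral_at P then Fq_integral P t
  else xget 0 [set v | exists G : gamma_triple,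
    [/\ represents_at P G,
        forall G', represents_at P G' -> (gt_N G <= gt_N G')%N
      & v = Fq_gamma G t]]%classic.

End HypergeometricSums.

Section DworkSurface.
Variable F : finFieldType.

Definition dwork_form (u : F) (y : 'rV[F]_4) : F :=
  \sum_(i < 4) y 0 i ^+ 4 - 4 * u^-1 * \prod_(i < 4) y 0 i.

Definition proportional (y z : 'rV[F]_4) : bool :=
  [exists c : F, (c != 0) && (z == c *: y)].

(* The F-points of X_u: classes of nonzero solutions up to scaling. *)
Definition dwork_points (u : F) : {set {set 'rV[F]_4}} :=
  equivalence_partition proportional
    [set y : 'rV[F]_4 | (y != 0) && (dwork_form u y == 0)].

End DworkSurface.

(* Main.v *)
Require Import Defs.
From mathcomp Require Import all_boot all_order all_algebra.
From mathcomp Require Import complex ring zify cyclic finfield.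
From mathcomp Require Import boolp classical_sets reals trigo.

(** Write q1 = q - 1, f for the quartic form and g for the Gauss sum.

    Counting. Summing psi(a f(y)) over all a and all y in F^4 gives q times the
    number N = 1 + q1 #X_u(F) of zeros of f. The term a = 0 is q^4. For a != 0
    the product y1 y2 y3 y4 matters only on the torus, so the points with a
    vanishing coordinate contribute powers of the sum of psi(a y^4)
    ([dwork_full_sumE]). On the torus psi(a y1^4) alone is expanded in the
    characters chi^k: the sum over y1 is then g(4k) up to a character value, the
    three other coordinates give equal factors, and the torus sum is a sum over
    k of g(-k) g(4k) chi^(-4k)(-4/u) times the cube of a sum of
    chi^j(a) g(-k-j) over the j with 4j = 0 modulo q1 ([dwork_torus_sumE]).
    Summing over a keeps the constant term of this polynomial in a quadratic or
    quartic character. For q = 3 modulo 4 put xj = g(-k - j q1/2): up to the same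
    character value the k-th term becomes g(4k) (x0^4 + 3 x0^2 x1^2). For
    q = 1 modulo 4 put xj = g(-k - j q1/4): after a shift of k in two of its
    parts it becomes g(4k) (x0^4 + 3 x0^2 x2^2 + 12 x0^2 x1 x3).

    Matching. Up to elementary factors the three products are the k-th terms of
    the three hypergeometric sums, by the Hasse-Davenport relations
    ([gsum_dup], [gsum_quad]) and the reflection formula for g(k) g(-k)
    ([gsum_reflect]). This needs 4k != 0 modulo q1, because the reflection
    formula loses a factor q at the trivial character. For the two or four other
    values of k the two sides differ, and the differences add up to the
    contribution of the points with a vanishing coordinate.

    The case q = 3 modulo 4. The parameters are then not integral at q, and F_q
    is the common value of the sums of all gamma triples with minimal N. Here
    the minimum is 1, also for ((1/4, 3/4); (1/2, 1)): the vector (-4, 2, 2) has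
    gcd 2, but adding the pair (1, -1) changes neither the quotient nor the sum.
    When N = 1 the sum depends only on the multisets of the absolute values of
    the negative and of the positive gamma_j. It is unchanged when a common
    element is removed from both ([gamma_term_cancel]), and a product of
    polynomials X^a - 1 determines the multiset of its exponents
    ([perm_eq_cyclo_prod]), so all these triples have the same sum
    ([Fq_gamma_represents]). *)

Set Implicit Arguments.
Unset Strict Implicit.
Unset Printing Implicit Defensive.

Import Order.TTheory GRing.Theory Num.Theory.

Local Open Scope ring_scope.

(** * Sums over a finite field *)

Section UnitSums.
Variables (F : finFieldType) (V : nmodType).
Implicit Type f : F -> V.

Lemma sum_unit_scale f (c : F) : c != 0 ->
  \sum_(x | x != 0) f x = \sum_(x | x != 0) f (c * x).
Proof.
move=> c0; rewrite (reindex (fun x => c * x)) /=.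
  by apply: eq_bigl => x; rewrite mulf_eq0 (negPf c0).
by exists (fun x => c^-1 * x) => x _; rewrite ?mulKf // mulVKf.
Qed.

Lemma sum_split0 f : \sum_x f x = f 0 + \sum_(x | x != 0) f x.
Proof. by rewrite (bigD1 0). Qed.

End UnitSums.

Lemma sum_multiples (V : nmodType) (e p : nat) (f : nat -> V) : (0 < p)%N ->
  \sum_(k < e * p | (p %| k)%N) f k = \sum_(j < e) f (j * p)%N.
Proof.
move=> p0; elim: e => [|e IHe]; first by rewrite mul0n !big_ord0.
rewrite big_ord_recr /= -IHe -[LHS](big_mkord (dvdn p) f).
rewrite (@big_cat_nat _ _ _ (e * p)) //=; last by rewrite mulSn leq_addl.
rewrite (big_mkord (dvdn p) f); congr (_ + _).
rewrite big_ltn_cond ?ltn_pmul2r // dvdn_mull //.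
rewrite big_nat_cond big1 ?addr0 // => i /andP[/andP[lo hi] /dvdnP[j ij]].
by move: lo hi; rewrite {}ij !ltn_pmul2r // ltnS ltnNge => /negP.
Qed.

(** Translation by 1 permutes F, so #|F| is zero in F; an integer prime to #|F| is
    therefore prime to the characteristic. *)
Lemma natr_coprime_neq0 (F : finFieldType) (k : nat) :
  coprime #|F| k -> k%:R != 0 :> F.
Proof.
have [p p_pr pF] := finPcharP F.
have cF0 : #|F|%:R = 0 :> F.
  apply: (addrI (\sum_(x : F) x)); rewrite addr0 -sum1_card natr_sum -big_split /=.
  by rewrite [RHS](reindex_inj (addIr 1)).
move=> cop; apply/negP=> k0.
have := dvdn_pcharf pF k; rewrite k0 => pk.
have := dvdn_pcharf pF #|F|; rewrite cF0 eqxx => pq.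
have : (p %| gcdn #|F| k)%N by rewrite dvdn_gcd pk pq.
by rewrite (eqP cop) dvdn1 => /eqP p1; rewrite p1 in p_pr.
Qed.

Section RowSums.
Variables (F : finFieldType) (V : nmodType).

Definition row4 (y1 y2 y3 y4 : F) : 'rV[F]_4 :=
  \row_i tnth [tuple y1; y2; y3; y4] i.

Lemma sum_row4 (H : 'rV[F]_4 -> V) :
  \sum_y H y = \sum_y2 \sum_y3 \sum_y4 \sum_y1 H (row4 y1 y2 y3 y4).
Proof.
rewrite pair_big /= pair_big /= pair_big /=.
rewrite (reindex (fun t : F * F * F * F => row4 t.2 t.1.1.1 t.1.1.2 t.1.2)) //.
exists (fun y : 'rV[F]_4 => (y 0 1, y 0 2%:R, y 0 3%:R, y 0 0)) => [[[[y2 y3] y4] y1] _|y _].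
  by rewrite !mxE.
apply/rowP; case; case=> [|[|[|[|//]]]] lti; rewrite mxE /=;
  rewrite [LHS](tnth_nth 0) /=; congr (y _ _); exact: val_inj.
Qed.

End RowSums.

(** * Characters and Gauss sums *)

Section CharacterSums.
Variables (C : numFieldType) (F : finFieldType) (psi chi : F -> C).
Let q : nat := #|F|.
Let q1 : nat := q.-1.

Hypothesis psiD : forall x y, psi (x + y) = psi x * psi y.
Hypothesis psi_neq0 : forall x, psi x != 0.
Hypothesis psi_nontrivial : exists x, psi x != 1.
Hypothesis chi_neq0 : forall x : F, x != 0 -> chi x != 0.
Hypothesis chiM : forall x y : F, x != 0 -> y != 0 -> chi (x * y) = chi x * chi y.
Hypothesis chi_expq1 : forall x : F, x != 0 -> chi x ^+ q1 = 1.
Hypothesis chi_faithful : forall m : nat, (0 < m < q1)%N ->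
  exists2 x : F, x != 0 & chi x ^+ m != 1.

Let q1_gt0 : (0 < q1)%N.
Proof. by have := card_finNzRing_gt1 F; rewrite /q1 /q; case: #|_| => [|[]]. Qed.

Let qE : q = q1.+1.
Proof. by rewrite prednK // ltnW // card_finNzRing_gt1. Qed.

Let q1C_neq0 : q1%:R != 0 :> C.
Proof. by rewrite pnatr_eq0 -lt0n. Qed.

Let qCE : q%:R = q1%:R + 1 :> C.
Proof. by rewrite qE -addn1 natrD. Qed.

Lemma card_units : #|[pred x : F | x != 0]| = q1.
Proof.
have := cardC1 (0 : F); rewrite -/q -/q1 => <-.
by apply: eq_card => x; rewrite !inE.
Qed.

Lemma sum1_units : \sum_(x : F | x != 0) 1 = q1%:R :> C.
Proof. by rewrite sumr_const card_units. Qed.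

Lemma psi0 : psi 0 = 1.
Proof. by apply: (mulfI (psi_neq0 0)); rewrite -psiD addr0 mulr1. Qed.

Lemma sum_psi : \sum_x psi x = 0.
Proof.
have [x0 nx0] := psi_nontrivial; apply/eqP.
rewrite -(mulIr_eq0 _ (mulIf (_ : psi x0 - 1 != 0))) ?subr_eq0 //.
rewrite mulrBr mulr1 subr_eq0 mulr_suml; apply/eqP.
rewrite [RHS](reindex_inj (addIr x0)); apply: eq_bigr => x _.
by rewrite psiD.
Qed.

Lemma sum_psi_scale (a : F) :
  \sum_x psi (x * a) = if a == 0 then q%:R else 0.
Proof.
case: eqP => [->|/eqP a0].
  under eq_bigr do rewrite mulr0 psi0.
  by rewrite sumr_const.
rewrite -[RHS]sum_psi [RHS](reindex_inj (mulIf a0)) //.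
Qed.

Lemma sum_psi_units (a : F) :
  \sum_(x | x != 0) psi (x * a) = (if a == 0 then q%:R else 0) - 1.
Proof. by rewrite -sum_psi_scale sum_split0 mul0r psi0 addrC addrK. Qed.

Definition ch (m : int) (x : F) : C := chi x ^ m.
Definition gsum (m : int) : C := \sum_(x | x != 0) psi x * ch m x.

Lemma ch_neq0 m x : x != 0 -> ch m x != 0.
Proof. by move=> x0; rewrite expfz_neq0 // chi_neq0. Qed.

Lemma chD m n x : x != 0 -> ch (m + n) x = ch m x * ch n x.
Proof. by move=> x0; rewrite /ch expfzDr // chi_neq0. Qed.

Lemma ch0 x : ch 0 x = 1.
Proof. by rewrite /ch expr0z. Qed.

Lemma chN m x : ch (- m) x = (ch m x)^-1.
Proof. by rewrite /ch -invr_expz. Qed.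

Lemma chi1 : chi 1 = 1.
Proof.
by apply: (mulfI (chi_neq0 (oner_neq0 F))); rewrite -chiM ?oner_neq0 ?mulr1.
Qed.

Lemma ch1 m : ch m 1 = 1.
Proof. by rewrite /ch chi1 exp1rz. Qed.

Lemma chM m x y : x != 0 -> y != 0 -> ch m (x * y) = ch m x * ch m y.
Proof. by move=> x0 y0; rewrite /ch chiM // expfzMl. Qed.

Lemma chV m x : x != 0 -> ch m x^-1 = (ch m x)^-1.
Proof.
move=> x0; apply: (mulfI (ch_neq0 m x0)).
by rewrite -chM ?invr_eq0 // mulfV // ch1 mulfV // ch_neq0.
Qed.

Lemma ch_mul m n x : ch (m * n) x = ch m x ^ n.
Proof. by rewrite /ch exprz_exp. Qed.

Lemma ch_mulC m n x : ch (m * n) x = ch n x ^ m.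
Proof. by rewrite mulrC ch_mul. Qed.

Lemma chX m (n : nat) x : x != 0 -> ch m (x ^+ n) = ch m x ^+ n.
Proof.
move=> x0; elim: n => [|n IHn]; first by rewrite !expr0 ch1.
by rewrite !exprS chM ?expf_neq0 // IHn.
Qed.

Lemma chXz m (n : nat) x : x != 0 -> ch m (x ^+ n) = ch (n%:Z * m) x.
Proof. by move=> x0; rewrite chX // ch_mulC. Qed.

Lemma ch_dvd m x : x != 0 -> (q1%:Z %| m)%Z -> ch m x = 1.
Proof.
move=> x0 /dvdzP[n ->]; rewrite ch_mulC.
by rewrite /ch -exprnP chi_expq1 // exp1rz.
Qed.

Lemma ch_eqmod m n x : x != 0 -> (q1%:Z %| m - n)%Z -> ch m x = ch n x.
Proof. by move=> x0 h; rewrite -(subrK n m) chD // ch_dvd // mul1r. Qed.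

Lemma gsum_eqmod m n : (q1%:Z %| m - n)%Z -> gsum m = gsum n.
Proof. by move=> h; apply: eq_bigr => x x0; rewrite (ch_eqmod x0 h). Qed.

Lemma sum_ch (m : int) :
  \sum_(x | x != 0) ch m x = if (q1%:Z %| m)%Z then q1%:R else 0.
Proof.
case: ifP => [h|/negbT h].
  by rewrite -sum1_units; apply: eq_bigr => x x0; rewrite ch_dvd.
have [x0 x0n0 nx0] : exists2 x, x != 0 & ch m x != 1.
  pose r := `|(m %% q1%:Z)%Z|%N.
  have rE : (m %% q1%:Z)%Z = r%:Z.
    by rewrite /r gez0_abs // modz_ge0 // eqz_nat -lt0n.
  have r1 : (0 < r < q1)%N.
    rewrite -(ltz_nat r) -rE ltz_pmod ?ltz_nat // andbT.
    rewrite lt0n; apply: contra h => /eqP r0.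
    by apply/dvdz_mod0P; rewrite rE r0.
  have [x x0 hx] := chi_faithful r1; exists x => //.
  rewrite (@ch_eqmod _ r%:Z) // -?rE.
    by rewrite -eqz_mod_dvd modz_mod.
apply/eqP; rewrite -(mulIr_eq0 _ (mulIf (_ : ch m x0 - 1 != 0))) ?subr_eq0 //.
rewrite mulrBr mulr1 subr_eq0 mulr_suml; apply/eqP.
rewrite [RHS](sum_unit_scale _ x0n0); apply: eq_bigr => x xn0.
by rewrite chM // mulrC.
Qed.

(** The unit group is cyclic, so a character of full order is injective. This
    gives the orthogonality relation in the exponent. *)
Lemma chi_eq1 x : x != 0 -> chi x = 1 -> x = 1.
Proof.
move=> x0 chix.
pose units : seq F := enum [pred x : F | x != 0].
have : has q1.-primitive_root units.
  apply: has_prim_root => //; rewrite ?enum_uniq //; last first.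
    by rewrite -cardE card_units.
  apply/allP=> y; rewrite mem_enum inE => y0; rewrite unity_rootE.
  apply/eqP/(mulfI y0); rewrite mulr1 -exprS -qE.
  exact: expf_card.
case/hasP=> w; rewrite mem_enum inE => w0 w_prim.
have powP y : y != 0 -> {i : 'I_q1 | y = w ^+ i}.
  move=> y0; apply: (prim_rootP w_prim); apply: (mulfI y0).
  by rewrite mulr1 -exprS -qE expf_card.
have [i xE] := powP x x0; have [i0|i0] := posnP i.
  by rewrite xE i0.
have [|y y0] := chi_faithful (_ : (0 < i < q1)%N); first by rewrite i0 /=.
have [j ->] := powP y y0.
have chiX z (n : nat) : z != 0 -> chi (z ^+ n) = chi z ^+ n.
  by move=> z0; have := chX 1 n z0; rewrite /ch !expr1z.
rewrite chiX // -exprM mulnC exprM -chiX // -xE chix expr1n.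
by rewrite eqxx.
Qed.

Lemma sum_ch_index x : x != 0 ->
  \sum_(k < q1) ch k%:Z x = if x == 1 then q1%:R else 0.
Proof.
move=> x0; case: eqP => [->|/eqP x1].
  by under eq_bigr do rewrite ch1; rewrite sumr_const card_ord.
have c1 : chi x - 1 != 0.
  by rewrite subr_eq0; apply: contra x1 => /eqP /chi_eq1 ->.
have := subrXX 1 (chi x) q1; rewrite chi_expq1 // expr1n subrr => /esym/eqP.
rewrite mulf_eq0 -oppr_eq0 opprB (negPf c1) /= => /eqP h; rewrite -[RHS]h.
by apply: eq_bigr => i _; rewrite expr1n mul1r.
Qed.

(** Fourier inversion on the unit group: the Gauss sums are the coefficients of
    psi. *)
Lemma psi_expand b : b != 0 ->
  q1%:R * psi b = \sum_(k < q1) gsum (- k%:Z) * ch k%:Z b.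
Proof.
move=> b0; under [RHS]eq_bigr => k _ do rewrite /gsum mulr_suml.
rewrite exchange_big /= (bigD1 b) //= [X in _ + X]big1 ?addr0.
  under eq_bigr => k _ do rewrite -mulrA -chD // addNr ch0 mulr1.
  by rewrite sumr_const card_ord mulr_natl.
move=> x /andP[x0 xb].
under eq_bigr => k _ do rewrite -mulrA chN -chV // -chM ?invr_eq0 //.
rewrite -mulr_sumr sum_ch_index ?mulf_neq0 ?invr_eq0 //.
case: eqP => [/(canRL (mulKf _))|]; last by rewrite mulr0.
by rewrite invr_eq0 invrK mulr1 => /(_ x0) bx; rewrite bx eqxx in xb.
Qed.

Lemma gsum0 : gsum 0 = -1.
Proof.
rewrite /gsum; under eq_bigr do rewrite ch0 mulr1.
by have := sum_psi; rewrite sum_split0 psi0 => /eqP; rewrite addrC addr_eq0 => /eqP.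
Qed.

Lemma gsum_scale a m : a != 0 ->
  \sum_(x | x != 0) psi (a * x) * ch m x = ch (- m) a * gsum m.
Proof.
move=> a0; rewrite /gsum (sum_unit_scale (fun x => psi x * ch m x) a0) mulr_sumr.
apply: eq_bigr => x x0; rewrite chM // mulrCA; congr (_ * _).
by rewrite [RHS]mulrA -chD // addNr ch0 mul1r.
Qed.

(** In the double sum put u = v w: the sum over v of psi (v * (w + 1)) singles out
    w = -1, and the other values of w add up to zero because chi^m is
    non-trivial. *)
Lemma gsum_reflect m : ~~ (q1%:Z %| m)%Z ->
  gsum m * gsum (- m) = ch m (-1) * q%:R.
Proof.
move=> hm.
have -> : gsum m * gsum (- m) =
    \sum_(w | w != 0) ch m w * \sum_(v | v != 0) psi (v * (w + 1)).
  rewrite {2}/gsum mulr_sumr.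
  under eq_bigr => v v0 do
    rewrite mulrC -mulrA -gsum_scale // mulr_sumr.
  rewrite exchange_big /=; apply: eq_bigr => w w0; rewrite mulr_sumr.
  apply: eq_bigr => v v0; by rewrite mulrA -psiD mulrDr mulr1 addrC mulrC.
under eq_bigr => w w0 do rewrite sum_psi_units mulrBr mulr1 addr_eq0.
rewrite sumrB sum_ch (negPf hm) subr0.
rewrite (bigD1 (-1)) ?oppr_eq0 ?oner_eq0 //= eqxx big1 ?addr0 // => i /andP[_].
by move/negPf->; rewrite mulr0.
Qed.

Lemma chN1_sqr m : ch m (-1) * ch m (-1) = 1.
Proof. by rewrite -chM ?oppr_eq0 ?oner_eq0 // mulrNN mulr1 ch1. Qed.

Lemma gsum_neq0 m : gsum m != 0.
Proof.
case hm: (q1%:Z %| m)%Z.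
  by rewrite (@gsum_eqmod m 0) ?subr0 // gsum0 oppr_eq0 oner_eq0.
have /eqP := gsum_reflect (negbT hm); apply: contraTneq => ->.
by rewrite mul0r eq_sym mulf_neq0 ?ch_neq0 ?oppr_eq0 ?oner_eq0 // pnatr_eq0 qE.
Qed.

Definition jacobi (a b : int) : C :=
  \sum_(x : F | (x != 0) && (x != 1)) ch a x * ch b (1 - x).

(** Group the double sum by s = x + y. The part s = 0 vanishes because chi^(a + b)
    is non-trivial, and for s != 0 scaling by s separates the two factors. *)
Lemma gsum_mul a b : ~~ (q1%:Z %| a + b)%Z ->
  gsum a * gsum b = gsum (a + b) * jacobi a b.
Proof.
move=> hab.
have -> : gsum a * gsum b = \sum_s psi s *
    \sum_(x | (x != 0) && (x != s)) ch a x * ch b (s - x).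
  under [RHS]eq_bigr do rewrite mulr_sumr.
  rewrite (exchange_big_dep (fun x => x != 0)) /=; last by move=> s x _ /andP[].
  rewrite /gsum mulr_suml; apply: eq_bigr => x x0; rewrite mulr_sumr.
  rewrite [RHS](reindex (fun y => y + x)) /=; last first.
    by exists (fun y => y - x) => y _; rewrite ?addrK ?subrK.
  apply: eq_big => [y|y y0].
    by rewrite x0 /= [x == _]eq_sym -[y + x == x]subr_eq0 addrK.
  by rewrite addrK psiD; ring.
rewrite (bigD1 0) //= [X in _ * X + _](_ : _ = 0); last first.
  under eq_bigr => x /andP[x0 _] do rewrite sub0r -mulN1r chM ?oppr_eq0 ?oner_eq0 // mulrCA -chD //.
  under eq_bigl => x do rewrite andbb.
  by rewrite -mulr_sumr sum_ch (negPf hab) mulr0.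
rewrite mulr0 add0r /gsum mulr_suml; apply: eq_bigr => s s0.
rewrite -mulrA; congr (_ * _).
rewrite /jacobi mulr_sumr (reindex (fun x => s * x)) /=; last first.
  by exists (fun x => s^-1 * x) => x _; rewrite ?mulKf // mulVKf.
apply: eq_big => [x|x].
  by rewrite mulf_eq0 (negPf s0) /= -{2}[s]mulr1 (inj_eq (mulfI s0)).
move=> /andP[]; rewrite mulf_eq0 (negPf s0) /= => x0 xs.
have x1 : 1 - x != 0.
  by rewrite subr_eq0; apply: contra xs => /eqP <-; rewrite mulr1.
rewrite -{2}[s]mulr1 -mulrBr !chM // chD //; ring.
Qed.

(** The characters whose e-th power is trivial count the e-th roots of x. *)
Lemma sum_pow (e : nat) (f : F -> C) :
  \sum_(y | y != 0) f (y ^+ e) =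
  \sum_(x | x != 0) f x * \sum_(k < q1 | (q1 %| e * k)%N) ch (- k%:Z) x.
Proof.
pose N (x : F) : C := \sum_(y : F | (y != 0) && (y ^+ e == x)) 1.
transitivity (\sum_(x | x != 0) f x * N x).
  rewrite (partition_big (fun y => y ^+ e) (fun x => x != 0)) /=; last first.
    by move=> y y0; rewrite expf_neq0.
  apply: eq_bigr => x x0; rewrite mulr_sumr; apply: eq_bigr => y /andP[_ /eqP->].
  by rewrite mulr1.
apply: eq_bigr => x x0; congr (_ * _); apply: (mulfI q1C_neq0).
transitivity (\sum_(y | y != 0) \sum_(k < q1) ch k (y ^+ e * x^-1)).
  rewrite /N mulr_sumr big_mkcondr /=; apply: eq_bigr => y y0.
  rewrite sum_ch_index ?mulf_neq0 ?expf_neq0 ?invr_eq0 // mulr1.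
  have -> // : (y ^+ e / x == 1) = (y ^+ e == x).
  by rewrite -[in RHS](inj_eq (mulIf (invr_neq0 x0))) mulfV.
rewrite exchange_big /= mulr_sumr [RHS]big_mkcond /=.
apply: eq_bigr => k _.
under eq_bigr => y y0 do rewrite chM ?expf_neq0 ?invr_eq0 // chXz // chV // -chN.
rewrite -mulr_suml sum_ch -PoszM dvdzE /=.
by case: ifP => // _; rewrite mul0r.
Qed.


(** * The Hasse-Davenport relations *)

Section Duplication.
Variable h : nat.
Hypothesis q1E : q1 = (2 * h)%N.

Let h_gt0 : (0 < h)%N.
Proof. by move: q1_gt0; rewrite q1E; case: (h). Qed.

Lemma two_neq0 : 2%:R != 0 :> F.
Proof.
apply: natr_coprime_neq0; rewrite -/q qE q1E coprime_sym.
by rewrite prime_coprime // dvdn2 /= negbK oddM.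
Qed.

Let four_neq0 : 4%:R != 0 :> F.
Proof. by rewrite (natrM _ 2 2) mulf_neq0 // two_neq0. Qed.

Lemma sum_sqr (f : F -> C) :
  \sum_(y | y != 0) f (y ^+ 2) =
  \sum_(x | x != 0) f x + \sum_(x | x != 0) f x * ch h%:Z x.
Proof.
rewrite sum_pow -big_split /=; apply: eq_bigr => x x0.
rewrite -[X in X + _]mulr1 -mulrDr; congr (_ * _).
transitivity (\sum_(k < 2 * h | (h %| k)%N) ch (- k%:Z) x).
  rewrite -q1E; apply: eq_bigl => k.
  by rewrite [X in (X %| _)%N = _]q1E dvdn_pmul2l.
rewrite (sum_multiples 2 (fun k => ch (- k%:Z) x)) // !big_ord_recl big_ord0 addr0 /=.
rewrite mul0n mul1n oppr0 ch0; congr (_ + _).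
apply: ch_eqmod => //; rewrite q1E; apply/dvdzP; exists (-1); lia.
Qed.

Lemma jacobiC a b : jacobi a b = jacobi b a.
Proof.
rewrite /jacobi (reindex (fun x => 1 - x)) /=; last first.
  by exists (fun x => 1 - x) => x _; rewrite subKr.
apply: eq_big => [x|x _]; last by rewrite subKr mulrC.
rewrite subr_eq0 -[X in _ && (_ != X)]subr0 (inj_eq (@subrI _ 1)) andbC.
by rewrite [1 == x]eq_sym.
Qed.

(** Since 4 x (1 - x) = 1 - (1 - 2 x)^2, the substitution z = 1 - 2 x turns the left
    side into a sum over squares, where the quadratic character chi^h appears. *)
Lemma jacobi_dup m : ~~ (q1%:Z %| m)%Z ->
  jacobi m m = ch (- m) 4%:R * jacobi m h%:Z.
Proof.
move=> hm; apply: (mulfI (ch_neq0 m four_neq0)).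
rewrite mulrA chN mulfV ?ch_neq0 // mul1r.
pose f n : C := if n == 1 then 0 else ch m (1 - n).
have -> : ch m 4%:R * jacobi m m = \sum_z f (z ^+ 2).
  rewrite (reindex (fun x => 1 - 2%:R * x)) /=; last first.
    exists (fun z => 2%:R^-1 * (1 - z)) => z _.
      by rewrite subKr mulKf // two_neq0.
    by rewrite mulVKf ?two_neq0 // subKr.
  rewrite /jacobi mulr_sumr big_mkcond /=; apply: eq_bigr => x _.
  have fE : 1 - (1 - 2%:R * x) ^+ 2 = 4%:R * (x * (1 - x)) by ring.
  have sq1 : ((1 - 2%:R * x) ^+ 2 == 1) = (x == 0) || (x == 1).
    rewrite eq_sym -subr_eq0 fE !mulf_eq0 (negPf four_neq0) /=.
    by rewrite subr_eq0 [1 == x]eq_sym.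
  rewrite /f sq1 fE; case: eqP => //= /eqP x0; case: eqP => //= /eqP x1.
  by rewrite !chM ?mulf_neq0 // subr_eq0 eq_sym.
rewrite sum_split0 sum_sqr expr0n /=.
have f0 : f 0 = 1 by rewrite /f eq_sym oner_eq0 subr0 ch1.
have -> : \sum_(x | x != 0) f x = -1.
  have := sum_ch m; rewrite (negPf hm).
  have -> : \sum_(x | x != 0) ch m x = \sum_x f x.
    rewrite [RHS](reindex (fun x => 1 - x)) /=; last first.
      by exists (fun x => 1 - x) => x _; rewrite subKr.
    rewrite big_mkcond; apply: eq_bigr => x _; rewrite /f subKr.
    by rewrite [1 - x == 1]eq_sym -[1 == 1 - x]subr_eq0 subKr; case: eqP.
  by rewrite sum_split0 f0 => /eqP; rewrite addrC addr_eq0 => /eqP.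
rewrite f0 addrA subrr add0r jacobiC /jacobi big_mkcondr /=.
apply: eq_bigr => x _; rewrite /f; case: eqP => //=; first by rewrite mul0r.
by rewrite mulrC.
Qed.

(** The expressions of g(m) g(m) and g(m) g(h) by Jacobi sums are compared through
    [jacobi_dup]. They require 2m != 0 and m + h != 0 modulo q - 1; the two excluded
    classes m = 0 and m = h are trivial. *)
Lemma gsum_dup m :
  gsum m * gsum (m + h%:Z) = ch (- m) 4%:R * gsum (2 * m) * gsum h%:Z.
Proof.
have q1Z : q1%:Z = 2 * h%:Z by rewrite q1E PoszM.
case hm: (q1%:Z %| m)%Z.
  have [c0 mE0] := elimT dvdzP hm.
  rewrite (@gsum_eqmod m 0) ?subr0 // (@gsum_eqmod (m + h%:Z) h%:Z) ?addrK //.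
  rewrite (@gsum_eqmod (2 * m) 0) ?subr0 ?dvdz_mull // ch_dvd ?rpredN ?(two_neq0, four_neq0) //.
  by rewrite gsum0; ring.
case hm2: (q1%:Z %| m + h%:Z)%Z.
  have [c mE] := elimT dvdzP hm2.
  rewrite (@gsum_eqmod (m + h%:Z) 0) ?subr0 // (@gsum_eqmod (2 * m) 0); last first.
    by apply/dvdzP; exists (2 * c - 1); rewrite subr0; lia.
  rewrite (@gsum_eqmod m h%:Z); last by apply/dvdzP; exists (c - 1); lia.
  have -> : ch (- m) 4%:R = 1.
    rewrite (@natrX _ 2 2) chXz ?two_neq0 // ch_dvd ?two_neq0 //.
    by apply/dvdzP; exists (1 - 2 * c); lia.
  by rewrite gsum0; ring.
have h2m : ~~ (q1%:Z %| m + m)%Z.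
  apply/negP=> /dvdzP[c mE].
  have {}mE : m = c * h%:Z by lia.
  have := divz_eq c 2; have := ltz_pmod c (isT : 0 < 2 :> int).
  have := modz_ge0 c (isT : 2 != 0 :> int).
  move: (c %/ 2)%Z (c %% 2)%Z => a b b0 b2 cE.
  have [bE|bE] : b = 0 \/ b = 1 by lia.
    by move/negP: hm; apply; apply/dvdzP; exists a; rewrite mE cE bE q1Z; ring.
  by move/negP: hm2; apply; apply/dvdzP; exists (a + 1); rewrite mE cE bE q1Z; ring.
have := gsum_mul h2m; rewrite jacobi_dup ?hm // => g2.
have := gsum_mul (negbT hm2) => gh.
apply: (mulfI (gsum_neq0 m)); rewrite mulrA g2.
have -> : m + m = 2 * m by ring.
transitivity (gsum (2 * m) * ch (- m) 4%:R * (gsum m * gsum h%:Z)).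
  by rewrite gh; ring.
ring.
Qed.

End Duplication.

(** Duplication at k, at k + p and at 2k; the constants are collected by
    duplication at p. *)
Lemma gsum_quad p (k : int) : q1 = (4 * p)%N ->
  gsum k * gsum (k + p%:Z) * gsum (k + 2 * p%:Z) * gsum (k + 3 * p%:Z) =
  ch (- k) (4 ^+ 4) * gsum (4 * k) * (gsum p%:Z * gsum (2 * p%:Z) * gsum (3 * p%:Z)).
Proof.
move=> q1E; have q1E2 : q1 = (2 * (2 * p))%N by rewrite q1E mulnA.
have dup := gsum_dup q1E2; rewrite PoszM in dup.
have f0 : 4 != 0 :> F by rewrite (natrM _ 2 2) mulf_neq0 // (two_neq0 q1E2).
have -> : gsum k * gsum (k + p%:Z) * gsum (k + 2 * p%:Z) * gsum (k + 3 * p%:Z) =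
  (gsum k * gsum (k + 2 * p%:Z)) * (gsum (k + p%:Z) * gsum (k + p%:Z + 2 * p%:Z)).
  have -> : k + p%:Z + 2 * p%:Z = k + 3 * p%:Z by ring.
  ring.
rewrite !dup.
have -> : gsum p%:Z * gsum (2 * p%:Z) * gsum (3 * p%:Z) =
  gsum (2 * p%:Z) * (gsum p%:Z * gsum (p%:Z + 2 * p%:Z)).
  have -> : p%:Z + 2 * p%:Z = 3 * p%:Z by ring.
  ring.
rewrite dup chX //.
have -> : 2 * (k + p%:Z) = 2 * k + 2 * p%:Z by ring.
have -> : ch (- (k + p%:Z)) 4 = ch (- k) 4 * ch (- p%:Z) 4.
  by rewrite -chD // opprD.
have -> : ch (- k) 4 * gsum (2 * k) * gsum (2 * p%:Z) * (ch (- k) 4 * ch (- p%:Z) 4 *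
   gsum (2 * k + 2 * p%:Z) * gsum (2 * p%:Z)) = ch (- k) 4 * ch (- k) 4 * ch (- p%:Z) 4 * gsum (2 * p%:Z) ^+ 2 * (gsum (2 * k) * gsum (2 * k + 2 * p%:Z)) by ring.
rewrite dup.
have -> : ch (- (2 * k)) 4 = ch (- k) 4 ^+ 2.
  by rewrite -mulrN ch_mulC.
have -> : 2 * (2 * k) = 4 * k by ring.
ring.
Qed.


(** * The character sums of the Dwork quartic *)

Definition quartic_sum (k : int) (a : F) : C :=
  \sum_(y | y != 0) psi (a * y ^+ 4) * ch (- 4 * k) y.

Lemma quartic_sumE k a : a != 0 ->
  quartic_sum k a = ch k a *
    \sum_(j < q1 | (q1 %| 4 * j)%N) ch j%:Z a * gsum (- k - j%:Z).
Proof.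
move=> a0; have := sum_pow 4 (fun x => psi (a * x) * ch (- k) x).
have -> : \sum_(y | y != 0) psi (a * y ^+ 4) * ch (- k) (y ^+ 4) =
          quartic_sum k a.
  by apply: eq_bigr => y y0; rewrite chXz // mulrN mulNr.
move=> ->; under eq_bigr => x x0 do rewrite mulr_sumr.
rewrite exchange_big /= mulr_sumr; apply: eq_bigr => j _.
under eq_bigr => x x0 do rewrite -mulrA -chD //.
by rewrite gsum_scale // opprB opprK addrC chD // mulrA.
Qed.

(** Only the quartic factor is expanded in characters; the sum over y that remains
    is the Gauss sum of the linear one. *)
Lemma sum_psi_quartic_linear a b : a != 0 -> b != 0 ->
  q1%:R * \sum_(y | y != 0) psi (a * y ^+ 4) * psi (b * y) =
  \sum_(k < q1) gsum (- k%:Z) * gsum (4 * k%:Z) * ch k%:Z a * ch (- 4 * k%:Z) b.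
Proof.
move=> a0 b0; rewrite mulr_sumr.
under eq_bigr => y y0 do rewrite mulrA psi_expand ?mulf_neq0 ?expf_neq0 // mulr_suml.
rewrite exchange_big /=; apply: eq_bigr => k _.
transitivity (gsum (- k%:Z) * ch k%:Z a *
   \sum_(y | y != 0) psi (b * y) * ch (4 * k%:Z) y).
  rewrite mulr_sumr; apply: eq_bigr => y y0.
  by rewrite chM ?expf_neq0 // chXz //; ring.
by rewrite gsum_scale // mulNr; ring.
Qed.

(** The sum over y1 is innermost because it is the one that
    [sum_psi_quartic_linear] evaluates. *)
Definition dwork_torus_sum (c a : F) : C :=
  \sum_(y2 | y2 != 0) \sum_(y3 | y3 != 0) \sum_(y4 | y4 != 0) \sum_(y1 | y1 != 0)
    psi (a * (y1 ^+ 4 + y2 ^+ 4 + y3 ^+ 4 + y4 ^+ 4 + c * (y1 * y2 * y3 * y4))).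

(** The powers of chi(a) that come from the three remaining coordinates cancel the
    ones produced by the sum over y1, which leaves a pure cube. *)
Lemma dwork_torus_sumE c a : c != 0 -> a != 0 ->
  q1%:R * dwork_torus_sum c a =
  \sum_(k < q1) gsum (- k%:Z) * gsum (4 * k%:Z) * ch (- 4 * k%:Z) c *
    (\sum_(j < q1 | (q1 %| 4 * j)%N) ch j%:Z a * gsum (- k%:Z - j%:Z)) ^+ 3.
Proof.
move=> c0 a0; pose A (k : nat) := gsum (- k%:Z) * gsum (4 * k%:Z).
transitivity (\sum_(y2 | y2 != 0) \sum_(y3 | y3 != 0) \sum_(y4 | y4 != 0)
  \sum_(k < q1) A k * ch k%:Z a * ch (- 4 * k%:Z) (a * c) *
    (psi (a * y2 ^+ 4) * ch (- 4 * k%:Z) y2) *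
    (psi (a * y3 ^+ 4) * ch (- 4 * k%:Z) y3) *
    (psi (a * y4 ^+ 4) * ch (- 4 * k%:Z) y4)).
  rewrite /dwork_torus_sum mulr_sumr; apply: eq_bigr => y2 y20.
  rewrite mulr_sumr; apply: eq_bigr => y3 y30.
  rewrite mulr_sumr; apply: eq_bigr => y4 y40.
  have b0 : a * c * y2 * y3 * y4 != 0 by rewrite !mulf_neq0.
  transitivity (psi (a * y2 ^+ 4) * psi (a * y3 ^+ 4) * psi (a * y4 ^+ 4) *
     (q1%:R * \sum_(y | y != 0) psi (a * y ^+ 4) * psi (a * c * y2 * y3 * y4 * y))).
    rewrite mulrCA; congr (_ * _); rewrite mulr_sumr; apply: eq_bigr => y y0.
    by rewrite -!psiD; congr psi; ring.
  rewrite sum_psi_quartic_linear // mulr_sumr; apply: eq_bigr => k _.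
  by rewrite !chM ?mulf_neq0 // /A; ring.
transitivity (\sum_(k < q1) A k * ch k%:Z a * ch (- 4 * k%:Z) (a * c) *
   quartic_sum k%:Z a ^+ 3).
  under eq_bigr => y2 _ do under eq_bigr => y3 _ do rewrite exchange_big /=.
  under eq_bigr => y2 _ do rewrite exchange_big /=.
  rewrite exchange_big /=; apply: eq_bigr => k _.
  under eq_bigr => y2 _ do under eq_bigr => y3 _ do rewrite -mulr_sumr -/(quartic_sum _ _).
  under eq_bigr => y2 _ do rewrite -mulr_suml -mulr_sumr -/(quartic_sum _ _).
  by rewrite -!mulr_suml -mulr_sumr -/(quartic_sum _ _); ring.
apply: eq_bigr => k _; rewrite quartic_sumE // exprMn /A chM //.
have : ch k%:Z a * ch (-4 * k%:Z) a * ch k%:Z a ^+ 3 = 1.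
  have -> : ch k%:Z a ^+ 3 = ch (3%:Z * k%:Z) a by rewrite ch_mulC.
  by rewrite -!chD // -(ch0 a); congr ch; ring.
by move=> e; rewrite -[RHS]mul1r -e; ring.
Qed.


Lemma sum4_prod (P : pred F) (g : F -> C) :
  \sum_(y2 | P y2) \sum_(y3 | P y3) \sum_(y4 | P y4) \sum_(y1 | P y1)
    g y1 * g y2 * g y3 * g y4 = (\sum_(y | P y) g y) ^+ 4.
Proof.
rewrite 3!exprS expr1.
rewrite mulr_suml; apply: eq_bigr => y2 _.
rewrite mulr_suml mulr_sumr; apply: eq_bigr => y3 _.
rewrite mulr_suml !mulr_sumr; apply: eq_bigr => y4 _.
by rewrite !mulr_sumr; apply: eq_bigr => y1 _; ring.
Qed.

(** The factor psi of the product term is 1 as soon as a coordinate vanishes, so off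
    the torus the summand is that of the diagonal form, whose sum is a fourth
    power. *)
Lemma dwork_full_sumE c a :
  \sum_y2 \sum_y3 \sum_y4 \sum_y1
    psi (a * (y1 ^+ 4 + y2 ^+ 4 + y3 ^+ 4 + y4 ^+ 4 + c * (y1 * y2 * y3 * y4)))
  = (1 + quartic_sum 0 a) ^+ 4 - quartic_sum 0 a ^+ 4 + dwork_torus_sum c a.
Proof.
pose g y := psi (a * y ^+ 4).
pose W y2 y3 y4 y1 := g y1 * g y2 * g y3 * g y4.
pose D y2 y3 y4 y1 := W y2 y3 y4 y1 * (psi (a * (c * (y1 * y2 * y3 * y4))) - 1).
have psiE y1 y2 y3 y4 :
   psi (a * (y1 ^+ 4 + y2 ^+ 4 + y3 ^+ 4 + y4 ^+ 4 + c * (y1 * y2 * y3 * y4))) =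
   W y2 y3 y4 y1 + D y2 y3 y4 y1.
  by rewrite !mulrDr !psiD /D /W /g; ring.
have qs0 : quartic_sum 0 a = \sum_(y | y != 0) g y.
  by apply: eq_bigr => y _; rewrite mulr0 ch0 mulr1.
have g0 : g 0 = 1 by rewrite /g expr0n mulr0 psi0.
have qs1 : 1 + quartic_sum 0 a = \sum_y g y by rewrite sum_split0 g0 qs0.
have -> : dwork_torus_sum c a = quartic_sum 0 a ^+ 4 +
  \sum_(y2 | y2 != 0) \sum_(y3 | y3 != 0) \sum_(y4 | y4 != 0)
    \sum_(y1 | y1 != 0) D y2 y3 y4 y1.
  rewrite qs0 -sum4_prod /dwork_torus_sum.
  by do 4!(rewrite -big_split /=; apply: eq_bigr => ? _); apply: psiE.
rewrite addrA subrK qs1 -(sum4_prod predT).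
have drop0 (f : F -> C) : f 0 = 0 -> \sum_(y | y != 0) f y = \sum_y f y.
  by move=> f0; rewrite sum_split0 f0 add0r.
have D0 y2 y3 y4 y1 : y1 * y2 * y3 * y4 = 0 -> D y2 y3 y4 y1 = 0.
  by rewrite /D => ->; rewrite !mulr0 psi0 subrr mulr0.
have -> : \sum_(y2 | y2 != 0) \sum_(y3 | y3 != 0) \sum_(y4 | y4 != 0)
    \sum_(y1 | y1 != 0) D y2 y3 y4 y1 =
    \sum_y2 \sum_y3 \sum_y4 \sum_y1 D y2 y3 y4 y1.
  rewrite drop0; last first.
    by do 3!(rewrite big1 // => ? _); apply: D0; rewrite !(mulr0, mul0r).
  apply: eq_bigr => y2 _; rewrite drop0; last first.
    by do 2!(rewrite big1 // => ? _); apply: D0; rewrite !(mulr0, mul0r).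
  apply: eq_bigr => y3 _; rewrite drop0; last first.
    by rewrite big1 // => ? _; apply: D0; rewrite !(mulr0, mul0r).
  by apply: eq_bigr => y4 _; rewrite drop0 // D0 ?mul0r.
by do 4!(rewrite -big_split /=; apply: eq_bigr => ? _); apply: psiE.
Qed.

Lemma card_dwork_affine (f : 'rV[F]_4 -> F) c :
  (forall y1 y2 y3 y4, f (row4 y1 y2 y3 y4) =
     y1 ^+ 4 + y2 ^+ 4 + y3 ^+ 4 + y4 ^+ 4 + c * (y1 * y2 * y3 * y4)) ->
  q%:R * #|[set y | f y == 0]|%:R = q%:R ^+ 4 + \sum_(a | a != 0)
    ((1 + quartic_sum 0 a) ^+ 4 - quartic_sum 0 a ^+ 4 + dwork_torus_sum c a).
Proof.
move=> fE; transitivity (\sum_y \sum_a psi (a * f y)).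
  under [RHS]eq_bigr do rewrite sum_psi_scale.
  rewrite -big_mkcond /= sumr_const -[RHS]mulr_natr; congr (_ * _%:R).
  by apply: eq_card => y; rewrite inE.
rewrite exchange_big /= sum_split0; congr (_ + _).
  under eq_bigr do rewrite mul0r psi0.
  by rewrite sumr_const card_mx mul1n natrX.
apply: eq_bigr => a _; rewrite -dwork_full_sumE sum_row4.
by do 4!(apply: eq_bigr => ? _); rewrite fE.
Qed.


(** * Terms of the sum of a gamma triple with N = 1 *)

(** The multiplicity of exp(2 pi i k / (q - 1)), and of its inverse, as a root of the
    product of the polynomials X^a - 1 for a in s. *)
Definition divisor_count (s : seq nat) (k : nat) : nat :=
  count (fun a => (q1 %| a * k)%N) s.

(** The lists N and P hold the absolute values of the negative and of the positive
    gamma_j. The power of -1 is the product of the values g(0), and the minimum of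
    the two multiplicities is the multiplicity of a root of the gcd. *)
Definition gamma_term (N P : seq nat) (t : F) (k : nat) : C :=
  (\prod_(a <- N) gsum (a * k)%N%:Z * \prod_(b <- P) gsum (- (b * k)%N%:Z))
  / (-1) ^+ (size N + size P)
  * q%:R ^ ((minn (divisor_count N k) (divisor_count P k))%:Z -
            (minn (divisor_count N 0) (divisor_count P 0))%:Z)
  * ch k%:Z (\prod_(a <- N) (- a%:R) ^- a * \prod_(b <- P) b%:R ^+ b * t).

Lemma gamma_term_perm N N' P P' t k : perm_eq N N' -> perm_eq P P' ->
  gamma_term N P t k = gamma_term N' P' t k.
Proof.
move=> hN hP; rewrite /gamma_term /divisor_count.
rewrite !(perm_big _ hN) !(perm_big _ hP) (perm_size hN) (perm_size hP).
by rewrite !(permP hN) !(permP hP).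
Qed.

Let qC_neq0 : q%:R != 0 :> C.
Proof. by rewrite pnatr_eq0 qE. Qed.

(** If chi^(a k) is non-trivial the two extra Gauss sums multiply to chi^(a k)(-1) q;
    the q is absorbed by the change of the exponent of q, and the sign by the
    factor (-a)^(-a) a^a = (-1)^a inside chi^k. If chi^(a k) is trivial, X^a - 1 also
    vanishes at the root in question and every change is trivial. *)
Lemma gamma_term_cancel a N P t k :
  a%:R != 0 :> F -> \prod_(b <- N) b%:R != 0 :> F ->
  \prod_(b <- P) b%:R != 0 :> F -> t != 0 ->
  gamma_term (a :: N) (a :: P) t k = gamma_term N P t k.
Proof.
move=> a0 N0 P0 t0; have prod0 (e : nat -> F -> F) s :
    (forall b x, x != 0 -> e b x != 0) -> \prod_(b <- s) b%:R != 0 :> F ->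
    \prod_(b <- s) e b b%:R != 0.
  move=> e0; elim: s => [|b s IHs]; first by rewrite !big_nil oner_neq0.
  by rewrite !big_cons !mulf_eq0 !negb_or => /andP[b0 /IHs->]; rewrite e0.
have chE : ch k%:Z (\prod_(b <- a :: N) (- b%:R) ^- b *
      \prod_(b <- a :: P) b%:R ^+ b * t) = ch (a * k)%N%:Z (-1) *
   ch k%:Z (\prod_(b <- N) (- b%:R) ^- b * \prod_(b <- P) b%:R ^+ b * t).
  rewrite PoszM -chXz ?oppr_eq0 ?oner_eq0 // -chM; last first.
  - rewrite !mulf_neq0 // ?(prod0 (fun b x => (- x) ^- b)) ?(prod0 (fun b x => x ^+ b)) //.
      by move=> b x x0; rewrite ?invr_eq0 expf_neq0 // ?oppr_eq0.
    by move=> b x x0; rewrite ?invr_eq0 expf_neq0 // ?oppr_eq0.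
  - by rewrite expf_neq0 // oppr_eq0 oner_eq0.
  congr ch; rewrite !big_cons.
  have -> : (-1) ^+ a = (- a%:R) ^- a * a%:R ^+ a :> F.
    rewrite [(- a%:R) ^+ a]exprNn invfM -mulrA mulVf ?expf_neq0 // mulr1.
    by rewrite -exprVn invrN1.
  ring.
rewrite /gamma_term chE /divisor_count /= !big_cons muln0 dvdn0.
rewrite addnS addSn !exprS.
rewrite -!addn_minr !PoszD.
set s := minn _ _; set s0 := minn _ _; set G := \prod_(b <- N) gsum _; set G' := \prod_(b <- P) gsum _.
set Y := ch k%:Z _; set e := (-1) ^+ _.
have e0 : e != 0 by rewrite expf_neq0 // oppr_eq0 oner_eq0.
have -> : (q1 %| a * k)%N%:Z + s%:Z - (true%:Z + s0%:Z) = (s%:Z - s0%:Z) + ((q1 %| a * k)%N%:Z - 1).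
  by rewrite [true%:Z]/(1 : int); ring.
rewrite (expfzDr _ _ qC_neq0).
have key : gsum (a * k)%N%:Z * gsum (- (a * k)%N%:Z) *
   q%:R ^ ((q1 %| a * k)%N%:Z - 1) * ch (a * k)%N%:Z (-1) = 1.
  have hz : (q1%:Z %| (a * k)%N%:Z)%Z = (q1 %| a * k)%N by rewrite dvdzE.
  case: (boolP (q1 %| a * k)%N) hz => h hz /=.
    rewrite (@gsum_eqmod (a * k)%N 0) ?subr0 // (@gsum_eqmod (- _) 0) ?subr0 ?rpredN //.
    rewrite gsum0 [true%:Z]/(1 : int) subrr expr0z ch_dvd ?oppr_eq0 ?oner_eq0 //.
    by ring.
  rewrite gsum_reflect ?hz // sub0r -exprnN expr1.
  by rewrite mulfK // chN1_sqr.
by rewrite -[RHS]mulr1 -[X in _ = _ * X]key; field.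
Qed.


(** * Comparison of the terms when q = 3 modulo 4 *)

Lemma dwork_torus_total c (Q : nat -> C) : c != 0 ->
  (forall k : nat, \sum_(a | a != 0)
     (\sum_(j < q1 | (q1 %| 4 * j)%N) ch j%:Z a * gsum (- k%:Z - j%:Z)) ^+ 3
     = q1%:R * Q k) ->
  \sum_(a | a != 0) dwork_torus_sum c a =
  \sum_(k < q1) gsum (- k%:Z) * gsum (4 * k%:Z) * ch (- 4 * k%:Z) c * Q k.
Proof.
move=> c0 QE; apply: (mulfI q1C_neq0); rewrite mulr_sumr.
under eq_bigr => a a0 do rewrite dwork_torus_sumE //.
rewrite exchange_big /= mulr_sumr; apply: eq_bigr => k _.
by rewrite -mulr_sumr QE; ring.
Qed.

Lemma sum_support (p : nat) (f : nat -> C) :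
  (forall k, (k < q1)%N -> ~~ (p %| k)%N -> f k = 0) ->
  \sum_(k < q1) f k = \sum_(k < q1 | (p %| k)%N) f k.
Proof.
move=> f0; rewrite [RHS]big_mkcond /=; apply: eq_bigr => k _.
by case: ifPn => // /(f0 k (ltn_ord k)).
Qed.

Lemma ch_four_opp (k : int) (x : F) : x != 0 ->
  ch (- 4 * k) (- x) = ch (- 4 * k) x.
Proof.
move=> x0; rewrite -[- x]mulN1r chM ?oppr_eq0 ?oner_eq0 //.
have -> : ch (- 4 * k) (-1) = 1; last by rewrite mul1r.
rewrite mulNr chN -(@chXz k 4) ?oppr_eq0 ?oner_eq0 //.
by rewrite -signr_odd expr0 ch1 invr1.
Qed.

Section OddHalf.
Variable h : nat.
Hypothesis q1E : q1 = (2 * h)%N.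
Hypothesis h_odd : odd h.

Let h_gt0 : (0 < h)%N. Proof. by case: (h) h_odd. Qed.

Let two0 : 2 != 0 :> F := two_neq0 q1E.

Let four0 : 4 != 0 :> F.
Proof. by rewrite (natrM _ 2 2) mulf_neq0. Qed.

Let dvd4 (k : nat) : (q1 %| 4 * k)%N = (h %| k)%N.
Proof.
have -> : (4 * k = 2 * (2 * k))%N by rewrite mulnA.
by rewrite q1E dvdn_pmul2l // Gauss_dvdr // coprimen2.
Qed.

Let torsion_sum (f : nat -> C) :
  \sum_(k < q1 | (h %| k)%N) f k = f 0%N + f h.
Proof.
transitivity (\sum_(k < 2 * h | (h %| k)%N) f k); first by rewrite -q1E.
by rewrite sum_multiples // !big_ord_recl big_ord0 addr0 mul0n mul1n.
Qed.

Let dvd_half k : (q1%:Z %| 2 * h%:Z * k)%Z.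
Proof. by rewrite q1E PoszM dvdz_mulr. Qed.

Let half_ndvd : ~~ (q1%:Z %| h%:Z)%Z.
Proof. by rewrite dvdzE /= gtnNdvd // q1E mulSn mul1n -[X in (X < _)%N]addn0 ltn_add2l. Qed.

Let ch_half_sqr a : a != 0 -> ch h%:Z a * ch h%:Z a = 1.
Proof.
by move=> a0; rewrite -chD // ch_dvd // q1E; apply/dvdzP; exists 1; lia.
Qed.

(** As h is odd, chi^h(-1) = -1, so the reflection formula gives -q. *)
Let gsum_half_sqr : gsum h%:Z * gsum h%:Z = - q%:R.
Proof.
transitivity (gsum h%:Z * gsum (- h%:Z)).
  by congr (_ * _); apply: gsum_eqmod; rewrite q1E; apply/dvdzP; exists 1; lia.
have m1 : -1 != 0 :> F by rewrite oppr_eq0 oner_eq0.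
rewrite gsum_reflect // -[ch h%:Z (-1)]mulr1.
have -> : ch h%:Z (-1) = -1; last by ring.
have hE := odd_double_half h; rewrite h_odd in hE.
have : ch 1 (-1) = -1.
  have := chN1_sqr 1; move/eqP; rewrite -expr2 sqrf_eq1 => /orP[|/eqP //].
  rewrite /ch expr1z => /eqP /(chi_eq1 m1) /eqP.
  rewrite -subr_eq0 -opprD oppr_eq0 => abs.
  by rewrite -(natrD _ 1 1) (negPf two0) in abs.
rewrite /ch expr1z -exprnP => ->.
by rewrite -signr_odd h_odd expr1.
Qed.

Let inner_sum (k : nat) a :
  \sum_(j < q1 | (q1 %| 4 * j)%N) ch j%:Z a * gsum (- k%:Z - j%:Z) =
  gsum (- k%:Z) + ch h%:Z a * gsum (- k%:Z - h%:Z).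
Proof.
under eq_bigl => j do rewrite dvd4.
rewrite (torsion_sum (fun j => ch j%:Z a * gsum (- k%:Z - j%:Z))).
by rewrite ch0 mul1r subr0.
Qed.

Let sum_ch_half : \sum_(a | a != 0) ch h%:Z a = 0.
Proof. by rewrite sum_ch (negPf half_ndvd). Qed.

Let average x y : \sum_(a | a != 0) (x + ch h%:Z a * y) = q1%:R * x.
Proof.
by rewrite big_split /= -mulr_suml sum_ch_half mul0r addr0 -sum1_units mulr_suml;
  apply: eq_bigr => a _; rewrite mul1r.
Qed.

Let gsum_sub_half (m : int) : gsum (m - h%:Z) = gsum (m + h%:Z).
Proof. apply: gsum_eqmod; rewrite q1E; apply/dvdzP; exists (-1); lia. Qed.

Let quartic_sum0 a : a != 0 -> quartic_sum 0 a = -1 + ch h%:Z a * gsum h%:Z.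
Proof.
move=> a0; rewrite quartic_sumE // ch0 mul1r (inner_sum 0) oppr0 gsum0.
by rewrite gsum_sub_half add0r.
Qed.

(** The last factor is the constant term of (x + c y)^3 modulo c^2 = 1, where
    x = g(-k), y = g(-k + h) and c is the quadratic character of a. *)
Let torus_term (c : F) (k : nat) : C :=
  gsum (- k%:Z) * gsum (4 * k%:Z) * ch (- 4 * k%:Z) c *
  (gsum (- k%:Z) ^+ 3 + 3 * gsum (- k%:Z) * gsum (- k%:Z + h%:Z) ^+ 2).

(** Both parts are averages over a of polynomials in chi^h(a), whose square is 1.
    The diagonal part is B^4 - (B - 1)^4 with B = chi^h(a) g(h) and B^2 = -q. *)
Lemma dwork_sum_odd_half c : c != 0 ->
  \sum_(a | a != 0)
    ((1 + quartic_sum 0 a) ^+ 4 - quartic_sum 0 a ^+ 4 + dwork_torus_sum c a) =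
  q1%:R * (6 * q%:R - 1) + \sum_(k < q1) torus_term c k.
Proof.
move=> c0; rewrite big_split /=; congr (_ + _).
  rewrite -(average _ (4 * gsum h%:Z * (1 - q%:R))); apply: eq_bigr => a a0.
  rewrite quartic_sum0 //; have := ch_half_sqr a0; have := gsum_half_sqr.
  set c1 := ch _ a; set g := gsum h => g2 c2.
  have -> : q%:R = - (g * g) by rewrite g2 opprK.
  (* Both squares are isolated so that they can be replaced by 1 and -q. *)
  transitivity (- (1 - 4 * (c1 * g) + 6 * (c1 * c1) * (g * g) - 4 * (c1 * c1) * c1 * (g * g * g))).
    ring.
  by rewrite c2; ring.
apply: (dwork_torus_total (Q := fun k => gsum (- k%:Z) ^+ 3 +
  3 * gsum (- k%:Z) * gsum (- k%:Z + h%:Z) ^+ 2)) => // k.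
rewrite -(average _ (3 * gsum (- k%:Z) ^+ 2 * gsum (- k%:Z + h%:Z) + gsum (- k%:Z + h%:Z) ^+ 3)).
apply: eq_bigr => a a0; rewrite inner_sum gsum_sub_half.
have := ch_half_sqr a0; set c1 := ch _ a; set x := gsum (- k%:Z).
set y := gsum (_ + _) => c2.
transitivity (x ^+ 3 + 3 * x ^+ 2 * y * c1 + 3 * x * y ^+ 2 * (c1 * c1) + y ^+ 3 * (c1 * c1) * c1); first by ring.
by rewrite c2; ring.
Qed.


Let quartic_twist (u : F) (k : nat) : u != 0 ->
  ch (- 4 * k%:Z) (- (4 * u^-1)) = ch k%:Z (u ^+ 4 / 4 ^+ 4).
Proof.
move=> u0; rewrite ch_four_opp ?mulf_neq0 ?invr_eq0 // mulNr chN -chV; last first.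
  by rewrite mulf_neq0 ?invr_eq0.
rewrite invfM invrK -(@chXz k%:Z 4) ?mulf_neq0 ?invr_eq0 //.
by rewrite exprMn exprVn mulrC.
Qed.

Let gamma_quartic t (k : nat) :
  gamma_term [:: 4] [:: 1; 1; 1; 1]%N t k =
  - gsum (4 * k%:Z) * gsum (- k%:Z) ^+ 4 *
  q%:R ^ ((minn (h %| k)%N (4 * (q1 %| k)))%N%:Z - 1) * ch k%:Z (t / 4 ^+ 4).
Proof.
rewrite /gamma_term /divisor_count /= !big_cons !big_nil.
rewrite !muln0 dvdn0 dvd4 !mul1n PoszM !expr1n !mulr1 /=.
have -> : (- 4) ^- 4 * t = t / 4 ^+ 4 :> F.
  by rewrite mulrC exprNn -signr_odd expr0 mul1r.
have -> : (-1) ^+ (1 + 4) = -1 :> C by ring.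
rewrite !addn0 invrN1.
have -> : ((q1 %| k) + ((q1 %| k) + ((q1 %| k) + (q1 %| k))) = 4 * (q1 %| k))%N by lia.
have -> : (minn true (true + (true + (true + true))))%N = 1%N by [].
by ring.
Qed.

Let gamma_quadratic t (k : nat) : t != 0 ->
  gamma_term [:: 4] [:: 2; 2]%N t k =
  - gsum (4 * k%:Z) * gsum (- (2 * k%:Z)) ^+ 2 *
  q%:R ^ ((minn (h %| k)%N (2 * (h %| k)))%N%:Z - 1) *
  (ch k%:Z (t / 4 ^+ 4) * ch k%:Z 4 ^+ 2).
Proof.
move=> t0; rewrite /gamma_term /divisor_count /= !big_cons !big_nil.
have -> : (q1 %| 2 * k)%N = (h %| k)%N by rewrite [X in (X %| _)%N = _]q1E dvdn_pmul2l.
rewrite !muln0 dvdn0 dvd4 !PoszM !mulr1 /=.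
rewrite -chX // -chM ?mulf_neq0 ?invr_eq0 ?expf_neq0 //.
have -> : (- 4) ^- 4 * (2 ^+ 2 * 2 ^+ 2) * t = t / 4 ^+ 4 * 4 ^+ 2 :> F.
  have -> : (- 4) ^+ 4 = 4 ^+ 4 :> F by ring.
  have -> : 2 ^+ 2 = 4 :> F by ring.
  by rewrite mulrC -expr2 mulrA.
have -> : (-1) ^+ (1 + 2) = -1 :> C by ring.
rewrite !addn0 invrN1 addnn -mul2n.
have -> : (minn true (true + true))%N = 1%N by [].
by ring.
Qed.

(** Here chi^(4k) is non-trivial, so both powers of q are q^-1 and the
    duplication formula identifies the second product. *)
Let torsion_free_term u k : u != 0 -> ~~ (h %| k)%N ->
  torus_term (- (4 * u^-1)) k + q%:R * gamma_term [:: 4] [:: 1; 1; 1; 1]%N (u ^+ 4) k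
   - 3 * q%:R ^+ 2 * gamma_term [:: 4] [:: 2; 2]%N (u ^+ 4) k = 0.
Proof.
move=> u0 hk; have q1k : (q1 %| k)%N = false.
  by apply/negbTE; apply: contra hk; apply: dvdn_trans; rewrite q1E dvdn_mull.
rewrite gamma_quartic gamma_quadratic ?expf_neq0 // /torus_term quartic_twist // (negPf hk) q1k /=.
rewrite /minn /= sub0r -exprnN expr1.
have := gsum_dup q1E (- k%:Z); rewrite opprK mulrN.
have := gsum_half_sqr.
set g := gsum h; set x := gsum (- k%:Z); set y := gsum (_ + _).
set w := ch k 4; set z := gsum (- (2 * k%:Z)); set G := gsum _; set Y := ch _ _ => g2 xy.
transitivity (G * Y * (3 * (x * y) ^+ 2 + 3 * q%:R * z ^+ 2 * w ^+ 2)).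
  by field.
rewrite xy; transitivity (G * Y * 3 * w ^+ 2 * z ^+ 2 * (g * g + q%:R)); first by ring.
by rewrite g2 addNr mulr0.
Qed.

(** At k = 0 and k = h the powers of q are not q^-1 throughout, and the excess is
    what the points off the torus contribute. *)
Let torsion_terms u : u != 0 ->
  let e k := torus_term (- (4 * u^-1)) k
   + q%:R * gamma_term [:: 4] [:: 1; 1; 1; 1]%N (u ^+ 4) k
   - 3 * q%:R ^+ 2 * gamma_term [:: 4] [:: 2; 2]%N (u ^+ 4) k in
  e 0%N + e h = - (q1%:R * (6 * q%:R - 1)).
Proof.
move=> u0 /=; rewrite /torus_term !gamma_quartic !gamma_quadratic ?expf_neq0 //.
rewrite !quartic_twist // !ch0 !dvdn0 dvdnn.
have -> : 0%:Z = 0 by []; rewrite !mulr0 !oppr0 add0r !addNr !gsum0 ?ch0.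
have q1h : (q1 %| h)%N = false by move: half_ndvd; rewrite dvdzE /= => /negbTE.
have u40 : u / 4 != 0 by rewrite mulf_neq0 ?invr_eq0.
have -> : ch h (u ^+ 4 / 4 ^+ 4) = 1.
  rewrite -exprVn -exprMn chXz // ch_dvd //.
  have -> : 4%:Z * h%:Z = 2 * h%:Z * 2 by ring.
  exact: dvd_half.
have -> : ch h 4 ^+ 2 = 1 by rewrite expr2 ch_half_sqr.
rewrite q1h.
rewrite (@gsum_eqmod (4 * h%:Z) 0); last first.
  rewrite subr0; have -> : 4 * h%:Z = 2 * h%:Z * 2 by ring.
  exact: dvd_half.
rewrite (@gsum_eqmod (- (2 * h%:Z)) 0); last first.
  by rewrite subr0 rpredN -[2 * _]mulr1; apply: dvd_half.
rewrite (@gsum_eqmod (- h%:Z) h%:Z); last first.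
  by rewrite q1E; apply/dvdzP; exists (-1); lia.
have -> : (minn true (4 * true))%N = 1%N by [].
have -> : (minn true (2 * true))%N = 1%N by [].
have -> : (minn true (4 * false))%N = 0%N by [].
rewrite subrr sub0r expr0z -exprnN expr1 gsum0 qCE.
have g2 := gsum_half_sqr; set g := gsum h in g2 *.
have q1g : q1%:R = - (g * g) - 1 by rewrite g2 qCE; ring.
have g_neq0 : g != 0 by apply: gsum_neq0.
rewrite q1g; field.
have -> : - (g * g) - 1 + 1 = - (g * g) by ring.
by rewrite oppr_eq0 mulf_neq0.
Qed.

(** The differences of the two sides over all k add up to minus the contribution of
    the points off the torus, so the identity holds after multiplication by
    q (q - 1). *)
Lemma dwork_identity_odd_half u n : u != 0 ->
  q%:R * (1 + q1%:R * n) = q%:R ^+ 4 + \sum_(a | a != 0)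
    ((1 + quartic_sum 0 a) ^+ 4 - quartic_sum 0 a ^+ 4
      + dwork_torus_sum (- (4 * u^-1)) a) ->
  n = q%:R ^+ 2 + q%:R + 1
    + (1 - q%:R)^-1 * \sum_(k < q1) gamma_term [:: 4] [:: 1; 1; 1; 1]%N (u ^+ 4) k
    - 3 * q%:R * ((1 - q%:R)^-1 * \sum_(k < q1) gamma_term [:: 4] [:: 2; 2]%N (u ^+ 4) k).
Proof.
move=> u0; have c0 : - (4 * u^-1) != 0 by rewrite oppr_eq0 mulf_neq0 ?invr_eq0.
pose e k := torus_term (- (4 * u^-1)) k
   + q%:R * gamma_term [:: 4] [:: 1; 1; 1; 1]%N (u ^+ 4) k
   - 3 * q%:R ^+ 2 * gamma_term [:: 4] [:: 2; 2]%N (u ^+ 4) k.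
have : \sum_(k < q1) e k = - (q1%:R * (6 * q%:R - 1)).
  rewrite (sum_support (p := h)) ?torsion_sum; first exact: torsion_terms.
  by move=> k _; apply: torsion_free_term.
rewrite dwork_sum_odd_half // sumrB big_split /= -!mulr_sumr.
set T := \sum_(k < q1) torus_term _ _; set S1 := \sum_(k < q1) _; set S2 := \sum_(k < q1) _.
move=> /(canRL (addrK _)) /(canRL (addrK _)) ->.
have q1_neq0 := q1C_neq0; have q_neq0 := qC_neq0; rewrite qCE in q_neq0 *.
move=> eqn; apply: (mulfI q_neq0); apply: (mulfI q1_neq0).
have -> : 1 - (q1%:R + 1) = - q1%:R :> C by ring.
apply: (addrI (q1%:R + 1)).
transitivity ((q1%:R + 1) * (1 + q1%:R * n)); first by ring.
by rewrite eqn; field.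
Qed.

End OddHalf.


(** * Comparison of the terms when q = 1 modulo 4 *)

Lemma sum_shift (f : int -> C) (c : nat) : (forall k, f (k + q1%:Z) = f k) ->
  \sum_(k < q1) f (k%:Z + c%:Z) = \sum_(k < q1) f k%:Z.
Proof.
move=> fq; elim: c => [|c <-]; first by apply: eq_bigr => k _; rewrite addr0.
have -> : q1 = q1.-1.+1 by rewrite prednK.
rewrite big_ord_recr [RHS]big_ord_recl /= addrC; congr (_ + _).
  have -> : q1.-1%:Z + c.+1%:Z = c%:Z + q1%:Z by move: q1_gt0; lia.
  by rewrite fq add0r.
by apply: eq_bigr => k _; congr f; rewrite /bump /=; lia.
Qed.

(** The pairs in ab are the integers (alpha_i (q - 1), beta_i (q - 1)). *)
Definition hyp_term (ab : seq (int * int)) (t : F) (k : nat) : C :=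
  (\prod_(x <- ab) (gsum (k%:Z + x.1) * gsum (- k%:Z - x.2) /
                    (gsum x.1 * gsum (- x.2)))) *
  ch k%:Z ((-1) ^+ size ab * t).

Section Quarter.
Variable p : nat.
Hypothesis q1E : q1 = (4 * p)%N.

Let q1E2 : q1 = (2 * (2 * p))%N.
Proof. by rewrite q1E mulnA. Qed.

Let p_gt0 : (0 < p)%N.
Proof. by move: q1_gt0; rewrite q1E; case: (p). Qed.

Let four0 : 4 != 0 :> F.
Proof. by rewrite (natrM _ 2 2) mulf_neq0 // (two_neq0 q1E2). Qed.

Let m1_neq0 : -1 != 0 :> F.
Proof. by rewrite oppr_eq0 oner_eq0. Qed.

Let dvd4 (k : nat) : (q1 %| 4 * k)%N = (p %| k)%N.
Proof. by rewrite [X in (X %| _)%N = _]q1E dvdn_pmul2l. Qed.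

Let torsion_sum (f : nat -> C) :
  \sum_(k < q1 | (p %| k)%N) f k = f 0%N + f p + f (2 * p)%N + f (3 * p)%N.
Proof.
transitivity (\sum_(k < 4 * p | (p %| k)%N) f k); first by rewrite -q1E.
by rewrite sum_multiples // !big_ord_recr big_ord0 /= add0r mul0n mul1n.
Qed.

Let ch_quarter4 a : a != 0 -> ch p%:Z a ^+ 4 = 1.
Proof.
move=> a0; rewrite -chX // chXz // ch_dvd // q1E; apply/dvdzP; exists 1; lia.
Qed.

Let inner_sum (k : nat) a :
  \sum_(j < q1 | (q1 %| 4 * j)%N) ch j%:Z a * gsum (- k%:Z - j%:Z) =
  gsum (- k%:Z) + ch p%:Z a * gsum (- k%:Z - p%:Z)
  + ch p%:Z a ^+ 2 * gsum (- k%:Z - 2 * p%:Z)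
  + ch p%:Z a ^+ 3 * gsum (- k%:Z - 3 * p%:Z).
Proof.
under eq_bigl => j do rewrite dvd4.
rewrite (torsion_sum (fun j => ch j%:Z a * gsum (- k%:Z - j%:Z))).
by rewrite ch0 mul1r subr0 !PoszM !ch_mulC.
Qed.

Let average x y z t : \sum_(a | a != 0)
   (x + ch p%:Z a * y + ch p%:Z a ^+ 2 * z + ch p%:Z a ^+ 3 * t) = q1%:R * x.
Proof.
have ndvd (i : nat) : (0 < i < 4)%N -> ~~ (q1%:Z %| i%:Z * p%:Z)%Z.
  move=> /andP[i0 i4]; rewrite -PoszM dvdzE /= q1E dvdn_pmul2r //.
  by rewrite gtnNdvd.
have avg0 (i : nat) : (0 < i < 4)%N -> \sum_(a | a != 0) ch p%:Z a ^+ i = 0.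
  move=> /ndvd hi; rewrite -[RHS](_ : \sum_(a | a != 0) ch (i%:Z * p%:Z) a = 0).
    by apply: eq_bigr => a a0; rewrite ch_mulC.
  by rewrite sum_ch (negPf hi).
rewrite !big_split /= -!mulr_suml -[\sum_(_ | _) ch _ _](eq_bigr _ (fun a _ => expr1 _)).
rewrite !avg0 // !mul0r !addr0 -sum1_units mulr_suml.
by apply: eq_bigr => a _; rewrite mul1r.
Qed.

Let g1 := gsum p%:Z.
Let g2 := gsum (2 * p%:Z).
Let g3 := gsum (3 * p%:Z).

Let gsumN1 : gsum (- p%:Z) = g3.
Proof. apply: gsum_eqmod; rewrite q1E; apply/dvdzP; exists (-1); lia. Qed.
Let gsumN2 : gsum (- (2 * p%:Z)) = g2.
Proof. apply: gsum_eqmod; rewrite q1E; apply/dvdzP; exists (-1); lia. Qed.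
Let gsumN3 : gsum (- (3 * p%:Z)) = g1.
Proof. apply: gsum_eqmod; rewrite q1E; apply/dvdzP; exists (-1); lia. Qed.

Let quartic_sum0 a : a != 0 -> quartic_sum 0 a =
  -1 + ch p%:Z a * g3 + ch p%:Z a ^+ 2 * g2 + ch p%:Z a ^+ 3 * g1.
Proof.
move=> a0; rewrite quartic_sumE // ch0 mul1r (inner_sum 0) oppr0 gsum0 !sub0r.
by rewrite gsumN1 gsumN2 gsumN3.
Qed.

Let x (j : nat) (k : int) := gsum (- k - j%:Z * p%:Z).

(** The last factor is the constant term of (x0 + x1 c + x2 c^2 + x3 c^3)^3 modulo
    c^4 = 1, where c is the quartic character of a. *)
Let torus_term (c : F) (k : int) : C :=
  x 0 k * gsum (4 * k) * ch (- 4 * k) c *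
  (x 0 k ^+ 3 + 6 * x 0 k * x 1 k * x 3 k + 3 * x 0 k * x 2 k ^+ 2
   + 3 * x 1 k ^+ 2 * x 2 k + 3 * x 2 k * x 3 k ^+ 2).

(** The three mixed products x0^2 x1 x3, x0 x1^2 x2 and x0 x2 x3^2 are shifts of one
    another, since k |-> k + p replaces x_j by x_(j+1) and preserves the other
    factors; their coefficients add up to 12. *)
Let symmetric_torus_term (c : F) (k : int) : C :=
  gsum (4 * k) * ch (- 4 * k) c *
  (x 0 k ^+ 4 + 3 * x 0 k ^+ 2 * x 2 k ^+ 2 + 12 * x 0 k ^+ 2 * x 1 k * x 3 k).

(** The constant term modulo c^4 = 1 of B^4 - (B - 1)^4, where
    B = c g3 + c^2 g2 + c^3 g1 is the sum of psi(a y^4) over all y in F. *)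
Let boundary : C :=
  12 * (g1 ^+ 2 * g2 + g3 ^+ 2 * g2) - 6 * (2 * g1 * g3 + g2 ^+ 2) - 1.

Let dwork_sum c : c != 0 ->
  \sum_(a | a != 0)
    ((1 + quartic_sum 0 a) ^+ 4 - quartic_sum 0 a ^+ 4 + dwork_torus_sum c a) =
  q1%:R * boundary + \sum_(k < q1) torus_term c k%:Z.
Proof.
move=> c0; rewrite big_split /=; congr (_ + _).
  (* The arguments are the coefficients of c, c^2 and c^3 modulo c^4 = 1. *)
  rewrite -(average _ (4 * g3 + 12 * g2 ^+ 2 * g3 + 12 * g1 * g3 ^+ 2 - 12 * g1 * g2 + 4 * g1 ^+ 3)
    (- 6 * g3 ^+ 2 + 4 * g2 ^+ 3 + 4 * g2 + 24 * g1 * g2 * g3 - 6 * g1 ^+ 2)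
    (4 * g3 ^+ 3 - 12 * g2 * g3 + 12 * g1 * g2 ^+ 2 + 12 * g1 ^+ 2 * g3 + 4 * g1)).
  apply: eq_bigr => a a0; rewrite quartic_sum0 // /boundary.
  by have := ch_quarter4 a0; move: (ch p a) => c1 c4; ring: c4.
have x0E (k : nat) : gsum (- k%:Z) = x 0 k by rewrite /x mul0r subr0.
rewrite (dwork_torus_total (Q := fun k => x 0 k ^+ 3 + 6 * x 0 k * x 1 k * x 3 k
   + 3 * x 0 k * x 2 k ^+ 2 + 3 * x 1 k ^+ 2 * x 2 k + 3 * x 2 k * x 3 k ^+ 2)) //.
  by apply: eq_bigr => k _; rewrite x0E.
move=> k; have x1E : gsum (- k%:Z - p%:Z) = x 1 k by rewrite /x mul1r.
under eq_bigr => a a0 do rewrite inner_sum x0E x1E -/(x 2 k) -/(x 3 k).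
move: (x 0 k) (x 1 k) (x 2 k) (x 3 k) => x0 x1 x2 x3.
(* Again the coefficients of c, c^2 and c^3 modulo c^4 = 1. *)
rewrite -(average _ (x3 ^+ 3 + 3 * x1 * x2 ^+ 2 + 3 * x1 ^+ 2 * x3 + 6 * x0 * x2 * x3 + 3 * x0 ^+ 2 * x1)
  (x2 ^+ 3 + 6 * x1 * x2 * x3 + 3 * x0 * x3 ^+ 2 + 3 * x0 * x1 ^+ 2 + 3 * x0 ^+ 2 * x2)
  (3 * x2 ^+ 2 * x3 + 3 * x1 * x3 ^+ 2 + x1 ^+ 3 + 6 * x0 * x1 * x2 + 3 * x0 ^+ 2 * x3)).
apply: eq_bigr => a a0.
by have := ch_quarter4 a0; move: (ch p a) => c1 c4; ring: c4.
Qed.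

Let torus_term_shift c : c != 0 ->
  \sum_(k < q1) torus_term c k%:Z = \sum_(k < q1) symmetric_torus_term c k%:Z.
Proof.
move=> c0.
pose f1 (k : int) := gsum (4 * k) * ch (- 4 * k) c * (x 0 k * x 1 k ^+ 2 * x 2 k).
pose f2 (k : int) := gsum (4 * k) * ch (- 4 * k) c * (x 0 k * x 2 k * x 3 k ^+ 2).
pose f3 (k : int) := gsum (4 * k) * ch (- 4 * k) c * (x 0 k ^+ 2 * x 1 k * x 3 k).
have xq j k : x j (k + q1%:Z) = x j k.
  by apply: gsum_eqmod; apply/dvdzP; exists (-1); lia.
have G4q k (n : nat) : gsum (4 * (k + n%:Z * p%:Z)) = gsum (4 * k).
  by apply: gsum_eqmod; rewrite q1E; apply/dvdzP; exists n%:Z; lia.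
have c4q k (n : nat) : ch (- 4 * (k + n%:Z * p%:Z)) c = ch (- 4 * k) c.
  by apply: ch_eqmod => //; rewrite q1E; apply/dvdzP; exists (- n%:Z); lia.
have q1p : q1%:Z = 4%:Z * p%:Z by rewrite q1E PoszM.
have f1E : \sum_(k < q1) f1 k%:Z = \sum_(k < q1) f3 k%:Z.
  rewrite -(@sum_shift f3 p); last first.
    by move=> k; rewrite /f3 !xq q1p G4q c4q.
  apply: eq_bigr => k _; rewrite /f3 /f1.
  have := G4q k 1%N; have := c4q k 1%N; rewrite !mul1r => -> ->.
  have -> : x 0 (k%:Z + p%:Z) = x 1 k by congr gsum; lia.
  have -> : x 1 (k%:Z + p%:Z) = x 2 k by congr gsum; lia.
  have -> : x 3 (k%:Z + p%:Z) = x 0 k.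
    by apply: gsum_eqmod; rewrite q1p; apply/dvdzP; exists (-1); lia.
  by congr (_ * _); ring.
have f2E : \sum_(k < q1) f2 k%:Z = \sum_(k < q1) f3 k%:Z.
  rewrite -(@sum_shift f3 (3 * p)); last first.
    by move=> k; rewrite /f3 !xq q1p G4q c4q.
  apply: eq_bigr => k _; rewrite /f3 /f2 PoszM.
  rewrite G4q c4q.
  have -> : x 0 (k%:Z + 3%:Z * p%:Z) = x 3 k by congr gsum; lia.
  have -> : x 1 (k%:Z + 3%:Z * p%:Z) = x 0 k.
    by apply: gsum_eqmod; rewrite q1p; apply/dvdzP; exists (-1); lia.
  have -> : x 3 (k%:Z + 3%:Z * p%:Z) = x 2 k.
    by apply: gsum_eqmod; rewrite q1p; apply/dvdzP; exists (-1); lia.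
  by congr (_ * _); ring.
pose f0 (k : int) := gsum (4 * k) * ch (- 4 * k) c *
  (x 0 k ^+ 4 + 3 * x 0 k ^+ 2 * x 2 k ^+ 2 + 6 * x 0 k ^+ 2 * x 1 k * x 3 k).
transitivity (\sum_(k < q1) f0 k%:Z + 3 * (\sum_(k < q1) f1 k%:Z + \sum_(k < q1) f2 k%:Z)).
  rewrite -big_split /= mulr_sumr -big_split /=; apply: eq_bigr => k _.
  by rewrite /torus_term /f0 /f1 /f2; ring.
rewrite f1E f2E -big_split /= mulr_sumr -big_split /=; apply: eq_bigr => k _.
by rewrite /symmetric_torus_term /f0 /f3; ring.
Qed.


Let eps := ch p%:Z (-1).

Let quartic_shifts : seq (int * int) := [:: (p%:Z, q1%:Z); (2 * p%:Z, q1%:Z); (3 * p%:Z, q1%:Z)].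
Let quadratic_shifts : seq (int * int) := [:: (p%:Z, 2 * p%:Z); (3 * p%:Z, q1%:Z)].
Let linear_shifts : seq (int * int) := [:: (2 * p%:Z, q1%:Z)].

Let gsum_subq1 k : gsum (- k - q1%:Z) = gsum (- k).
Proof. by apply: gsum_eqmod; apply/dvdzP; exists (-1); lia. Qed.

Let gsumq1 : gsum (- q1%:Z) = -1.
Proof. by rewrite -sub0r -oppr0 gsum_subq1 oppr0 gsum0. Qed.

Let quartic_termE u k : u != 0 -> hyp_term quartic_shifts u k =
  - (gsum (k%:Z + p%:Z) * gsum (k%:Z + 2 * p%:Z) * gsum (k%:Z + 3 * p%:Z)
     * gsum (- k%:Z) ^+ 3) / (g1 * g2 * g3) * (ch k (-1) * ch k u).
Proof.
move=> u0; rewrite /hyp_term !big_cons big_nil /= !gsum_subq1 gsumq1 chM ?expf_neq0 //.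
have -> : (-1) ^+ 3 = -1 :> F by ring.
have n1 : g1 != 0 := gsum_neq0 _; have n2 : g2 != 0 := gsum_neq0 _.
have n3 : g3 != 0 := gsum_neq0 _.
rewrite -/g1 -/g2 -/g3; field; exact/and3P.
Qed.

Let quadratic_termE u k : u != 0 -> hyp_term quadratic_shifts u k =
  - (gsum (k%:Z + p%:Z) * gsum (k%:Z + 3 * p%:Z) * gsum (- k%:Z - 2 * p%:Z)
     * gsum (- k%:Z)) / (g1 * g2 * g3) * ch k u.
Proof.
move=> u0; rewrite /hyp_term !big_cons big_nil /= gsum_subq1 gsumq1 gsumN2.
have -> : (-1) ^+ 2 * u = u by rewrite -signr_odd expr0 mul1r.
have n1 : g1 != 0 := gsum_neq0 _; have n2 : g2 != 0 := gsum_neq0 _.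
have n3 : g3 != 0 := gsum_neq0 _.
rewrite -/g1 -/g3; field; exact/and3P.
Qed.

Let linear_termE u k : u != 0 -> hyp_term linear_shifts u k =
  - (gsum (k%:Z + 2 * p%:Z) * gsum (- k%:Z)) / g2 * (ch k (-1) * ch k u).
Proof.
move=> u0; rewrite /hyp_term !big_cons big_nil /= gsum_subq1 gsumq1 chM ?expf_neq0 //.
have n2 : g2 != 0 := gsum_neq0 _.
rewrite expr1 -/g2; field; exact: n2.
Qed.

(** The difference of the k-th terms of the two sides, after both have been
    multiplied by q (q - 1). *)
Let error (u : F) (k : nat) : C :=
  symmetric_torus_term (- (4 * u^-1)) k%:Z + q%:R * hyp_term quartic_shifts (u ^+ 4) k
  + 3 * q%:R ^+ 2 * hyp_term quadratic_shifts (u ^+ 4) k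
  + 12 * eps * q%:R ^+ 2 * hyp_term linear_shifts (u ^+ 4) k.

Let quartic_twist (u : F) (k : nat) : u != 0 ->
  ch (- 4 * k%:Z) (- (4 * u^-1)) = ch (- k%:Z) (4 ^+ 4) * ch k%:Z (u ^+ 4).
Proof.
move=> u0; rewrite ch_four_opp ?mulf_neq0 ?invr_eq0 //.
rewrite chM ?invr_eq0 // chV //.
have -> : ch (-4 * k%:Z) 4 = ch (- k%:Z) (4 ^+ 4).
  by rewrite chXz //; congr ch; lia.
by congr (_ * _); rewrite chXz // mulNr chN invrK.
Qed.

Let gsum_reflect_shift (k : int) (j : nat) : ~~ (p%:Z %| k)%Z ->
  gsum (k + j%:Z * p%:Z) * gsum (- k - j%:Z * p%:Z) = ch k (-1) * eps ^+ j * q%:R.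
Proof.
move=> hk; have -> : - k - j%:Z * p%:Z = - (k + j%:Z * p%:Z) by rewrite opprD.
rewrite gsum_reflect ?chD // ?ch_mulC //.
apply: contra hk; rewrite q1E PoszM => /dvdzP[c kE].
by apply/dvdzP; exists (c * 4 - j%:Z); lia.
Qed.

Let eps_sqr : eps * eps = 1 := chN1_sqr p.

Let ndvd_torsion (j : nat) : (0 < j < 4)%N -> ~~ (q1%:Z %| j%:Z * p%:Z)%Z.
Proof.
move=> /andP[j0 j4]; rewrite -PoszM dvdzE /= q1E dvdn_pmul2r //.
by rewrite gtnNdvd.
Qed.

Let g13 : g1 * g3 = eps * q%:R.
Proof. by rewrite -gsumN1 gsum_reflect // -[p%:Z]mul1r (ndvd_torsion (j := 1)). Qed.

Let g22 : g2 * g2 = q%:R.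
Proof.
rewrite -{2}gsumN2 gsum_reflect ?(ndvd_torsion (j := 2)) //.
by rewrite ch_mulC -exprnP expr2 eps_sqr mul1r.
Qed.

Let sign_cases (s : C) : s * s = 1 -> s = 1 \/ s = -1.
Proof. by move/eqP; rewrite -expr2 sqrf_eq1 => /orP[]/eqP; [left|right]. Qed.

(** The Hasse-Davenport relation replaces g(4k) by g(k) g(k + p) g(k + 2p) g(k + 3p)
    and the reflection formula expresses each xj by the corresponding factor. *)
Let error_torsion_free u k : u != 0 -> ~~ (p %| k)%N -> error u k = 0.
Proof.
move=> u0 hk; rewrite /error quartic_termE ?quadratic_termE ?linear_termE ?expf_neq0 // /symmetric_torus_term.
have hk' : ~~ (p%:Z %| k%:Z)%Z by rewrite dvdzE.
have r j : gsum (- k%:Z - j%:Z * p%:Z) = ch k (-1) * eps ^+ j * q%:R / gsum (k%:Z + j%:Z * p%:Z).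
  by rewrite -gsum_reflect_shift // mulrAC mulfV ?mul1r // gsum_neq0.
have /esym := gsum_quad k q1E; rewrite quartic_twist // -/g1 -/g2 -/g3.
rewrite /x !r; have := r 0%N; rewrite !mul0r subr0 addr0 => ->.
rewrite !mul1r.
have s2 := chN1_sqr k; have e2 := eps_sqr.
have n1 : g1 != 0 := gsum_neq0 _; have n2 : g2 != 0 := gsum_neq0 _.
have qn := qC_neq0.
have g3E : g3 = eps * q%:R / g1 by rewrite -g13 mulrC mulKf.
have := gsum_neq0 (k%:Z); have := gsum_neq0 (k%:Z + p%:Z).
have := gsum_neq0 (k%:Z + 2%:Z * p%:Z); have := gsum_neq0 (k%:Z + 3%:Z * p%:Z).
set G0 := gsum k; set G1 := gsum (k%:Z + p%:Z); set G2 := gsum (k%:Z + 2 * _); set G3 := gsum (k%:Z + 3 * _).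
set s := ch k (-1) in s2 *; set w := ch (- k%:Z) _; set G := gsum (4 * _); set U := ch k _.
move=> G3n G2n G1n G0n quad.
have n3 : g3 != 0 := gsum_neq0 _.
have -> : G * (w * U) = G0 * G1 * G2 * G3 / (g1 * g2 * g3) * U.
  by rewrite -quad; field; exact/and3P.
(* With both signs explicit and g3 eliminated, only a rational identity remains. *)
rewrite g3E; case: (sign_cases s2) => ->; case: (sign_cases e2) => ->; field;
  by rewrite n1 n2 qn G0n G1n G2n G3n.
Qed.

(** At the multiples of p all Gauss sums are among g(0), g1, g2 and g3, and the
    characters are powers of chi^p(-1). *)
Let error_at u (j : nat) a1 a2 a3 b0 b1 b2 b3 : u != 0 ->
  gsum (j%:Z * p%:Z + p%:Z) = a1 -> gsum (j%:Z * p%:Z + 2 * p%:Z) = a2 ->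
  gsum (j%:Z * p%:Z + 3 * p%:Z) = a3 -> gsum (- (j%:Z * p%:Z)) = b0 ->
  gsum (- (j%:Z * p%:Z) - p%:Z) = b1 -> gsum (- (j%:Z * p%:Z) - 2 * p%:Z) = b2 ->
  gsum (- (j%:Z * p%:Z) - 3 * p%:Z) = b3 ->
  error u (j * p)%N = - (b0 ^+ 4 + 3 * b0 ^+ 2 * b2 ^+ 2 + 12 * b0 ^+ 2 * b1 * b3)
    + q%:R * (- (a1 * a2 * a3 * b0 ^+ 3) / (g1 * g2 * g3) * eps ^+ j)
    + 3 * q%:R ^+ 2 * (- (a1 * a3 * b2 * b0) / (g1 * g2 * g3))
    + 12 * eps * q%:R ^+ 2 * (- (a2 * b0) / g2 * eps ^+ j).
Proof.
move=> u0 <- <- <- <- <- <- <-.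
have c0 : - (4 * u^-1) != 0 by rewrite oppr_eq0 mulf_neq0 ?invr_eq0.
rewrite /error quartic_termE ?quadratic_termE ?linear_termE ?expf_neq0 // /symmetric_torus_term /x !PoszM.
have dvd_jp (i : int) : (q1%:Z %| 4 * i * (j%:Z * p%:Z))%Z.
  by rewrite q1E; apply/dvdzP; exists (i * j%:Z); lia.
rewrite (@gsum_eqmod (4 * _) 0) ?subr0; last by have := dvd_jp 1; rewrite mulr1.
rewrite (@ch_dvd (- 4 * _)) //; last by have := dvd_jp (-1); rewrite mulrN1.
have -> : ch (j%:Z * p%:Z) (u ^+ 4) = 1.
  by rewrite chXz // ch_dvd //; have := dvd_jp 1; rewrite mulr1.
by rewrite gsum0 mul1r (ch_mulC j%:Z) -exprnP; ring.
Qed.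

Let error_torsion u : u != 0 ->
  error u 0 + error u p + error u (2 * p) + error u (3 * p) = - (q1%:R * boundary).
Proof.
move=> u0; pose g0 := gsum 0; have g0E : g0 = -1 := gsum0.
(* The indices of the Gauss sums only matter modulo 4 p; c is the quotient. *)
have tors (a b c : int) : a = c * (4 * p%:Z) + b -> gsum a = gsum b.
  by move=> abc; apply: gsum_eqmod; rewrite q1E; apply/dvdzP; exists c; lia.
rewrite -[error u 0]/(error u (0 * p)) -[in error u p](mul1n p).
have error_jp j a1 a2 a3 b0 b1 b2 b3 := @error_at u j a1 a2 a3 b0 b1 b2 b3 u0.
(* The arguments are the values of g at (j + 1) p, (j + 2) p, (j + 3) p and then at
   -(j + i) p for i = 0, 1, 2, 3. *)
rewrite (error_jp 0%N g1 g2 g3 g0 g3 g2 g1); try by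
  first [apply: (tors _ _ 0); lia | apply: (tors _ _ 1); lia
        | apply: (tors _ _ (-1)); lia | apply: (tors _ _ (-2)); lia].
rewrite (error_jp 1%N g2 g3 g0 g3 g2 g1 g0); try by
  first [apply: (tors _ _ 0); lia | apply: (tors _ _ 1); lia
        | apply: (tors _ _ (-1)); lia | apply: (tors _ _ (-2)); lia].
rewrite (error_jp 2%N g3 g0 g1 g2 g1 g0 g3); try by
  first [apply: (tors _ _ 0); lia | apply: (tors _ _ 1); lia
        | apply: (tors _ _ (-1)); lia | apply: (tors _ _ (-2)); lia].
rewrite (error_jp 3%N g0 g1 g2 g1 g0 g3 g2); try by
  first [apply: (tors _ _ 0); lia | apply: (tors _ _ 1); lia
        | apply: (tors _ _ (-1)); lia | apply: (tors _ _ (-2)); lia].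
rewrite g0E /boundary.
have n1 : g1 != 0 := gsum_neq0 _; have n2 : g2 != 0 := gsum_neq0 _.
have g3E : g3 = eps * q%:R / g1 by rewrite -g13 mulrC mulKf.
have q1g : q1%:R = g2 * g2 - 1 by rewrite g22 qCE; ring.
rewrite g3E q1g -g22.
by case: (sign_cases eps_sqr) => ->; field; rewrite n1 n2.
Qed.

Lemma dwork_identity_quarter u n : u != 0 ->
  q%:R * (1 + q1%:R * n) = q%:R ^+ 4 + \sum_(a | a != 0)
    ((1 + quartic_sum 0 a) ^+ 4 - quartic_sum 0 a ^+ 4
      + dwork_torus_sum (- (4 * u^-1)) a) ->
  n = q%:R ^+ 2 + q%:R + 1
    + (1 - q%:R)^-1 * \sum_(k < q1) hyp_term quartic_shifts (u ^+ 4) k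
    + 3 * q%:R * ((1 - q%:R)^-1 * \sum_(k < q1) hyp_term quadratic_shifts (u ^+ 4) k)
    + 12 * eps * q%:R * ((1 - q%:R)^-1 * \sum_(k < q1) hyp_term linear_shifts (u ^+ 4) k).
Proof.
move=> u0; have c0 : - (4 * u^-1) != 0 by rewrite oppr_eq0 mulf_neq0 ?invr_eq0.
have : \sum_(k < q1) error u k = - (q1%:R * boundary).
  rewrite (sum_support (p := p)) ?torsion_sum; first exact: error_torsion.
  by move=> k _; apply: error_torsion_free.
rewrite dwork_sum // torus_term_shift // /error !big_split /= -!mulr_sumr.
set T := \sum_(k < q1) symmetric_torus_term _ _; set S1 := \sum_(k < q1) _.
set S2 := \sum_(k < q1) _; set S3 := \sum_(k < q1) _.
move=> /(canRL (addrK _)) /(canRL (addrK _)) /(canRL (addrK _)) ->.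
have q1_neq0 := q1C_neq0; have q_neq0 := qC_neq0; rewrite qCE in q_neq0 *.
move=> eqn; apply: (mulfI q_neq0); apply: (mulfI q1_neq0).
have -> : 1 - (q1%:R + 1) = - q1%:R :> C by ring.
apply: (addrI (q1%:R + 1)).
transitivity ((q1%:R + 1) * (1 + q1%:R * n)); first by ring.
by rewrite eqn; field.
Qed.

End Quarter.

End CharacterSums.

(** * Products of polynomials X^a - 1 *)

Section RootsOfUnity.
Variable R : realType.
Local Notation e := (expi2pi R).

Lemma expi2piD x y : e (x + y) = e x * e y.
Proof.
rewrite /expi2pi rmorphD /= mulrDr cosD sinD.
by congr Complex; ring.
Qed.

Lemma expi2pi0 : e 0 = 1.
Proof. by rewrite /expi2pi rmorph0 mulr0 cos0 sin0. Qed.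

Lemma expi2piMn x n : e (x *+ n) = e x ^+ n.
Proof.
elim: n => [|n IHn]; first by rewrite mulr0n expi2pi0.
by rewrite mulrS expi2piD IHn exprS.
Qed.

Lemma expi2pi_int (n : int) : e n%:~R = 1.
Proof.
have e1 : e 1 = 1.
  rewrite /expi2pi rmorph1 mulr1 mulr_natl cos2pi sin2pi //.
have enat (m : nat) : e m%:~R = 1 by rewrite -pmulrn expi2piMn e1 expr1n.
case: n => m; first exact: enat.
rewrite NegzE mulrNz -[LHS]mulr1 -[X in _ * X](enat m.+1) -expi2piD addNr.
exact: expi2pi0.
Qed.

(** For 0 < f < 1 the sine of pi f is positive, whereas cos (2 pi f) = 1 would make
    it vanish. *)
Lemma expi2pi_eq1 x : (e x == 1) = (x \is a Num.int).
Proof.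
apply/idP/idP => [|/intrP[n ->]]; last by rewrite expi2pi_int.
have -> : x = (Num.floor x)%:~R + (x - (Num.floor x)%:~R) by rewrite addrC subrK.
rewrite expi2piD expi2pi_int mul1r.
have f0 : 0 <= x - (Num.floor x)%:~R by rewrite subr_ge0 floor_le.
have f1 : x - (Num.floor x)%:~R < 1 by rewrite ltrBlDl -[1]/(1%:~R) -intrD floorD1_gt.
move: (x - _) f0 f1 => f f0 f1 /eqP[cosf _].
have [->|fn0] := eqVneq f 0; first by rewrite addr0 intr_int.
exfalso; have f_gt0 : 0 < f by rewrite lt_def fn0.
have : 0 < sin (pi * ratr f : R).
  apply: sin_gt0_pi; rewrite mulr_gt0 ?pi_gt0 ?ltr0q //=.
  by rewrite -[X in _ < X]mulr1 ltr_pM2l ?pi_gt0 // -(rmorph1 (@ratr R)) ltr_rat.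
have : cos (pi * ratr f + pi * ratr f) = 1 :> R.
  by rewrite -cosf; congr cos; ring.
rewrite cosD -!expr2 cos2sin2 => h.
have /eqP : sin (pi * ratr f) ^+ 2 *+ 2 = 0 :> R.
  by rewrite -[RHS](subrr 1) -{2}h; ring.
by rewrite mulrn_eq0 /= sqrf_eq0 => /eqP->; rewrite ltxx.
Qed.

Lemma expi2pi_half : e (1 / 2) = -1.
Proof.
have : e (1 / 2) ^+ 2 = 1 by rewrite -expi2piMn -(expi2pi_int 1).
move/eqP; rewrite sqrf_eq1 => /orP[|/eqP //].
rewrite expi2pi_eq1 => /intrP[n /(congr1 ( *%R^~ 2))]; rewrite divfK // => h.
have /eqP : (1 : int)%:~R = (n * 2)%:~R :> rat by rewrite intrM -h.
by rewrite eqr_int; move=> /eqP; lia.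
Qed.

Lemma expi2pi_quarter_sqr : e (1 / 4) ^+ 2 = -1.
Proof. by rewrite -expi2piMn -expi2pi_half; congr e. Qed.

Lemma expi2pi_three_quarters : e (3 / 4) = - e (1 / 4).
Proof.
have -> : 3 / 4 = 1 / 2 + 1 / 4 :> rat by [].
by rewrite expi2piD expi2pi_half mulN1r.
Qed.

Lemma expi2pi_div_exp (n : int) (d a : nat) : (0 < d)%N ->
  (e (n%:~R / d%:R) ^+ a == 1) = (d%:Z %| n * a%:Z)%Z.
Proof.
move=> d0; rewrite -expi2piMn expi2pi_eq1 -[_ *+ a]mulr_natr.
have dn0 : d%:R != 0 :> rat by rewrite pnatr_eq0 -lt0n.
apply/intrP/dvdzP => [[c hc]|[c hc]]; exists c.
  apply/eqP; rewrite -(eqr_int rat) !intrM -hc.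
  by apply/eqP; rewrite -!pmulrn; field.
rewrite mulrAC.
have -> : n%:~R * a%:R = c%:~R * d%:R :> rat.
  by have := congr1 (fun z : int => z%:~R : rat) hc; rewrite !intrM -!pmulrn.
by rewrite mulfK.
Qed.

Definition cyclo_prod (s : seq nat) : {poly R[i]} := \prod_(a <- s) ('X^a - 1).

Lemma Xn_sub1_neq0 a : (0 < a)%N -> 'X^a - 1 != 0 :> {poly R[i]}.
Proof. by move=> a0; rewrite -size_poly_eq0 size_XnsubC. Qed.

Lemma cyclo_prod_neq0 s : all (leq 1) s -> cyclo_prod s != 0.
Proof.
rewrite /cyclo_prod; elim: s => [|a s IHs]; first by rewrite big_nil oner_neq0.
by rewrite big_cons /= => /andP[a0 /IHs s0]; rewrite mulf_neq0 // Xn_sub1_neq0.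
Qed.

(** In characteristic zero X^a - 1 has only simple roots: the cofactor of X - z takes
    the value a z^(a - 1) at z. *)
Lemma mup_Xn_sub1 z a : (0 < a)%N -> mup z ('X^a - 1 : {poly R[i]}) = (z ^+ a == 1).
Proof.
move=> a0; case: eqP => [za|/eqP za]; last first.
  by rewrite mupNroot // /root !hornerE subr_eq0.
have -> : 'X^a - 1 = ('X - z%:P) * \sum_(i < a) 'X^(a.-1 - i) * z%:P ^+ i.
  by rewrite -subrXX -rmorphXn za.
have nroot : ~~ root (\sum_(i < a) 'X^(a.-1 - i) * z%:P ^+ i) z.
  rewrite /root horner_sum.
  have -> : \sum_(i < a) ('X^(a.-1 - i) * z%:P ^+ i).[z] = a%:R * z ^+ a.-1.
    transitivity (\sum_(i < a) z ^+ a.-1); last by rewrite sumr_const card_ord mulr_natl.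
    apply: eq_bigr => i _; rewrite -rmorphXn /= !hornerE -exprD subnK //.
    by rewrite -ltnS prednK.
  rewrite mulf_neq0 ?pnatr_eq0 -?lt0n // expf_neq0 //.
  by apply/eqP => z0; move/eqP: za; rewrite z0 expr0n eqn0Ngt a0 eq_sym oner_eq0.
by rewrite mupMl // -['X - _]expr1 mup_XsubCX eqxx.
Qed.

Lemma mup_cyclo_prod z s : all (leq 1) s ->
  mup z (cyclo_prod s) = count (fun a => z ^+ a == 1) s.
Proof.
rewrite /cyclo_prod; elim: s => [|a s IHs] /=.
  by rewrite big_nil mupNroot // root1.
move=> /andP[a0 s0]; rewrite big_cons mupM ?Xn_sub1_neq0 ?cyclo_prod_neq0 //.
by rewrite IHs // mup_Xn_sub1.
Qed.

Lemma mup_gcdp (z : R[i]) p q : p != 0 -> q != 0 ->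
  mup z (gcdp p q) = minn (mup z p) (mup z q).
Proof.
move=> p0 q0; have g0 : gcdp p q != 0 by rewrite gcdp_eq0 negb_and p0.
have : ('X - z%:P) ^+ mup z (gcdp p q) %| gcdp p q by rewrite -mup_geq.
rewrite dvdp_gcd -!mup_geq // => le_g; apply/eqP; rewrite eqn_leq leq_min le_g.
by rewrite mup_geq // dvdp_gcd -!mup_geq // geq_minl geq_minr.
Qed.

(** The largest exponent is the largest order of a root of unity at which the
    product vanishes, so it is the same on both sides and can be cancelled. *)
Lemma perm_eq_cyclo_prod s t : all (leq 1) s -> all (leq 1) t ->
  cyclo_prod s = cyclo_prod t -> perm_eq s t.
Proof.
have max_mem u : u != [::] -> \max_(a <- u) a \in u.
  elim: u => [//|a [|b u] IHu] _; first by rewrite big_cons big_nil maxn0 mem_head.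
  rewrite big_cons; case: (leqP a (\max_(x <- b :: u) x)) => _; last exact: mem_head.
  by rewrite inE IHu ?orbT.
have le_max u v : all (leq 1) u -> all (leq 1) v -> u != [::] ->
    cyclo_prod u = cyclo_prod v -> (\max_(a <- u) a <= \max_(a <- v) a)%N.
  move=> u0 v0 /max_mem mu uv; have m0 := allP u0 _ mu.
  set m := \max_(a <- u) a in mu m0 *.
  have rootE a : (e (1%:~R / m%:R) ^+ a == 1) = (m %| a)%N.
    by rewrite expi2pi_div_exp // mul1r dvdzE.
  have : (0 < count (fun a => e (1%:~R / m%:R) ^+ a == 1%R) v)%N.
    rewrite -mup_cyclo_prod // -uv mup_cyclo_prod // -has_count.
    by apply/hasP; exists m => //=; rewrite rootE.
  rewrite -has_count => /hasP[b bv]; rewrite rootE => mb.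
  apply: leq_trans (dvdn_leq (allP v0 _ bv) mb) _.
  by rewrite (big_rem b) //= leq_maxl.
elim: {s}(size s) {-2}s (leqnn (size s)) t => [|n IHn] s.
  rewrite leqn0 size_eq0 => /eqP-> t _ t0.
  have [->//|tn] := eqVneq t [::].
  have mt := max_mem t tn => st.
  have := mup_cyclo_prod 1 t0; rewrite -st /cyclo_prod big_nil mupNroot ?root1 //.
  move/esym/eqP; rewrite -leqn0 leqNgt -has_count => /hasP[].
  by exists (\max_(a <- t) a) => //; rewrite expr1n.
move=> sn t s0 t0 st; have [s_nil|snil] := eqVneq s [::].
  by apply: IHn => //; rewrite s_nil.
have tnil : t != [::].
  apply: contra_eq_neq st => ->; apply/eqP => st.
  have := mup_cyclo_prod 1 s0; rewrite st /cyclo_prod big_nil mupNroot ?root1 //.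
  move/esym/eqP; rewrite -leqn0 leqNgt -has_count => /hasP[].
  by exists (\max_(a <- s) a); rewrite ?max_mem ?expr1n.
have mE : \max_(a <- s) a = \max_(a <- t) a.
  by apply/eqP; rewrite eqn_leq !le_max.
have ms := max_mem s snil; have mt := max_mem t tnil; rewrite -mE in mt.
set m := \max_(a <- s) a in ms mt.
rewrite (perm_trans (perm_to_rem ms)) // perm_sym (perm_trans (perm_to_rem mt)) //.
rewrite perm_cons perm_sym; apply: IHn.
- by rewrite size_rem // -ltnS (leq_trans _ sn) // prednK //; case: (s) ms.
- by apply/allP => a /mem_rem; apply: allP.
- by apply/allP => a /mem_rem; apply: allP.
apply: (mulfI (Xn_sub1_neq0 (allP s0 _ ms))).
transitivity (cyclo_prod s); first by rewrite /cyclo_prod (big_rem m ms).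
by rewrite st /cyclo_prod (big_rem m mt).
Qed.

End RootsOfUnity.

(** * Gamma triples with N = 1 *)

Lemma tofrac_div_eq (D : idomainType) (a b c d : D) : b != 0 -> d != 0 ->
  (tofrac a / tofrac b = tofrac c / tofrac d <-> a * d = c * b).
Proof.
move=> b0 d0; have B0 : tofrac b != 0 by rewrite tofrac_eq0.
have D0 : tofrac d != 0 by rewrite tofrac_eq0.
split=> [/eqP|h]; first by rewrite eqr_div // -!tofracM tofrac_eq => /eqP.
by apply/eqP; rewrite eqr_div // -!tofracM h.
Qed.

Section GammaTripleParts.
Variables (R : realType) (G : gamma_triple).
Hypothesis N1 : gt_N G = 1%N.
Local Notation gam := (tnth (gt_gamma G)).

Definition neg_part : seq nat :=
  [seq `|gam j|%N | j <- enum 'I_(gt_dim G).+2 & gam j < 0].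
Definition pos_part : seq nat :=
  [seq `|gam j|%N | j <- enum 'I_(gt_dim G).+2 & 0 < gam j].

Lemma big_neg_part (T : Type) (idx : T) (op : Monoid.com_law idx) (f : nat -> T) :
  \big[op/idx]_(a <- neg_part) f a = \big[op/idx]_(j | gam j < 0) f `|gam j|%N.
Proof. by rewrite big_map big_filter big_enum_cond. Qed.

Lemma big_pos_part (T : Type) (idx : T) (op : Monoid.com_law idx) (f : nat -> T) :
  \big[op/idx]_(a <- pos_part) f a = \big[op/idx]_(j | 0 < gam j) f `|gam j|%N.
Proof. by rewrite big_map big_filter big_enum_cond. Qed.

Lemma big_gamma (T : Type) (idx : T) (op : Monoid.com_law idx) (f : int -> T) :
  \big[op/idx]_j f (gam j) =
  op (\big[op/idx]_(a <- neg_part) f (- a%:Z)) (\big[op/idx]_(b <- pos_part) f b%:Z).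
Proof.
rewrite (bigID (fun j => gam j < 0)) /= big_neg_part big_pos_part; congr (op _ _).
  by apply: eq_bigr => j gj; rewrite abszE ltr0_norm ?opprK.
apply: eq_big => [j|j]; rewrite -leNgt le_eqVlt eq_sym.
  by rewrite (negPf (gt_gamma_neq0 j)).
by rewrite (negPf (gt_gamma_neq0 j)) /= => gj; rewrite abszE gtr0_norm.
Qed.

Lemma prod_gamma (K : comNzRingType) (f : int -> K) :
  \prod_j f (gam j) =
  (\prod_(a <- neg_part) f (- a%:Z)) * (\prod_(b <- pos_part) f b%:Z).
Proof. exact: big_gamma. Qed.

Lemma neg_part_gt0 : all (leq 1) neg_part.
Proof. by apply/allP => a /mapP[j _ ->]; rewrite absz_gt0 gt_gamma_neq0. Qed.

Lemma pos_part_gt0 : all (leq 1) pos_part.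
Proof. by apply/allP => a /mapP[j _ ->]; rewrite absz_gt0 gt_gamma_neq0. Qed.

Let zeta1 : zeta R (gt_N G) = 1.
Proof. by rewrite /zeta N1 invr1 -(expi2pi_int R 1). Qed.

Lemma gt_numE : gt_num R G = cyclo_prod R neg_part.
Proof.
rewrite /cyclo_prod big_neg_part; apply: eq_bigr => j _.
by rewrite zeta1 exp1rz.
Qed.

Lemma gt_denE : gt_den R G = cyclo_prod R pos_part.
Proof.
rewrite /cyclo_prod big_pos_part; apply: eq_bigr => j _.
by rewrite zeta1 exp1rz.
Qed.

Lemma s_deltaE (q : nat) (m : nat) : (0 < q.-1)%N ->
  s_delta R G q (- m%:Z) =
  minn (count (fun a => (q.-1 %| a * m)%N) neg_part)
       (count (fun a => (q.-1 %| a * m)%N) pos_part).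
Proof.
move=> q0; rewrite /s_delta gt_numE gt_denE mup_gcdp ?cyclo_prod_neq0 ?neg_part_gt0 ?pos_part_gt0 //.
rewrite !mup_cyclo_prod ?neg_part_gt0 ?pos_part_gt0 //.
by congr minn; apply: eq_count => a; rewrite expi2pi_div_exp // mulNr rpredN dvdzE abszM mulnC.
Qed.

Lemma representsE n (P : hyp_param n) :
  represents R G P <->
  (\prod_j ('X - (expi2pi R (tnth (hp_alpha P) j))%:P)) * cyclo_prod R pos_part =
  cyclo_prod R neg_part * \prod_j ('X - (expi2pi R (tnth (hp_beta P) j))%:P).
Proof.
rewrite /represents gt_numE gt_denE.
apply: tofrac_div_eq; last by rewrite cyclo_prod_neq0 ?pos_part_gt0.
by apply/prodf_neq0 => j _; rewrite polyXsubC_eq0.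
Qed.

End GammaTripleParts.


(** * The parameters of the theorem *)

Section Triples.

Definition quartic_gamma : 5.-tuple int := [tuple -4; 1; 1; 1; 1].
(** The vector (-4, 2, 2) has the required quotient but is not primitive; the pair
    (1, -1) makes the gcd equal to 1 and cancels from the quotient. *)
Definition quadratic_gamma : 5.-tuple int := [tuple -4; 2; 2; 1; -1].

Lemma quartic_triple_neq0 (j : 'I_5) : tnth quartic_gamma j != 0.
Proof. by case: j; do 5!case=> //. Qed.

Lemma quartic_triple_sum : \sum_j tnth quartic_gamma j = 0.
Proof. by rewrite !big_ord_recl big_ord0. Qed.

Lemma quartic_triple_gcd :
  \big[gcdn/0%N]_j `|tnth quartic_gamma j|%N = 1%N.
Proof. by rewrite !big_ord_recl big_ord0. Qed.

Definition quartic_triple : gamma_triple :=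
  @GammaTriple 3 _ [tuple 0; 0; 0; 0; 0] 1
    quartic_triple_neq0 quartic_triple_sum quartic_triple_gcd isT.

Lemma quadratic_triple_neq0 (j : 'I_5) : tnth quadratic_gamma j != 0.
Proof. by case: j; do 5!case=> //. Qed.

Lemma quadratic_triple_sum : \sum_j tnth quadratic_gamma j = 0.
Proof. by rewrite !big_ord_recl big_ord0. Qed.

Lemma quadratic_triple_gcd :
  \big[gcdn/0%N]_j `|tnth quadratic_gamma j|%N = 1%N.
Proof. by rewrite !big_ord_recl big_ord0. Qed.

Definition quadratic_triple : gamma_triple :=
  @GammaTriple 3 _ [tuple 0; 0; 0; 0; 0] 1
    quadratic_triple_neq0 quadratic_triple_sum quadratic_triple_gcd isT.

Variable R : realType.

Lemma cyclo_prod_quartic_neg : cyclo_prod R (neg_part quartic_triple) = 'X^4 - 1.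
Proof.
by rewrite /cyclo_prod big_neg_part big_mkcond !big_ord_recl big_ord0 /= !mulr1.
Qed.

Lemma cyclo_prod_quartic_pos : cyclo_prod R (pos_part quartic_triple) = ('X - 1) ^+ 4.
Proof.
rewrite /cyclo_prod big_pos_part big_mkcond !big_ord_recl big_ord0 /= !mulr1 mul1r.
rewrite ?expr1; ring.
Qed.

Lemma cyclo_prod_quadratic_neg :
  cyclo_prod R (neg_part quadratic_triple) = ('X^4 - 1) * ('X - 1).
Proof.
by rewrite /cyclo_prod big_neg_part big_mkcond !big_ord_recl big_ord0 /= !mulr1 !mul1r.
Qed.

Lemma cyclo_prod_quadratic_pos :
  cyclo_prod R (pos_part quadratic_triple) = ('X^2 - 1) ^+ 2 * ('X - 1).
Proof.
rewrite /cyclo_prod big_pos_part big_mkcond !big_ord_recl big_ord0 /= !mulr1 !mul1r.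
by rewrite -mulrA.
Qed.

End Triples.

Section TheoremData.
Variable R : realType.
Local Notation e := (expi2pi R).
Definition quartic_params := @HypParam 3 [tuple 1 / 4; 2 / 4; 3 / 4] [tuple 1; 1; 1] isT.
Definition quadratic_params := @HypParam 2 [tuple 1 / 4; 3 / 4] [tuple 1 / 2; 1] isT.
Definition linear_params := @HypParam 1 [tuple 1 / 2] [tuple 1] isT.

Let iC : {poly R[i]} := (e (1 / 4))%:P.
Let iC2 : iC ^+ 2 = -1.
Proof. by rewrite -rmorphXn /= expi2pi_quarter_sqr rmorphN1. Qed.

Lemma quartic_alphaE : \prod_j ('X - (e (tnth (hp_alpha quartic_params) j))%:P) * ('X - 1) = 'X^4 - 1.
Proof.
rewrite !big_ord_recl big_ord0 /= !(tnth_nth 0) /=.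
have -> : 2 / 4 = 1 / 2 :> rat by [].
rewrite expi2pi_half expi2pi_three_quarters !rmorphN rmorph1 -/iC.
ring: iC2.
Qed.

Lemma quartic_betaE : \prod_j ('X - (e (tnth (hp_beta quartic_params) j))%:P) = ('X - 1) ^+ 3.
Proof.
rewrite !big_ord_recl big_ord0 /= !(tnth_nth 0) /= (expi2pi_int R 1) rmorph1; ring.
Qed.

Lemma quadratic_alphaE : \prod_j ('X - (e (tnth (hp_alpha quadratic_params) j))%:P) * ('X^2 - 1) = 'X^4 - 1.
Proof.
rewrite !big_ord_recl big_ord0 /= !(tnth_nth 0) /=.
rewrite expi2pi_three_quarters !rmorphN -/iC.
ring: iC2.
Qed.

Lemma quadratic_betaE : \prod_j ('X - (e (tnth (hp_beta quadratic_params) j))%:P) = 'X^2 - 1.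
Proof.
rewrite !big_ord_recl big_ord0 /= !(tnth_nth 0) /= (expi2pi_int R 1) expi2pi_half.
rewrite !rmorphN rmorph1; ring.
Qed.

End TheoremData.

(** * The points of the surface *)

Section PointCount.
Variables (F : finFieldType) (u : F).

Lemma dwork_form_scale (c : F) y : dwork_form u (c *: y) = c ^+ 4 * dwork_form u y.
Proof.
by rewrite /dwork_form !big_ord_recl !big_ord0 !mxE; ring.
Qed.

Lemma dwork_form_row4 y1 y2 y3 y4 : dwork_form u (row4 y1 y2 y3 y4) =
  y1 ^+ 4 + y2 ^+ 4 + y3 ^+ 4 + y4 ^+ 4 + - (4 * u^-1) * (y1 * y2 * y3 * y4).
Proof.
rewrite /dwork_form !big_ord_recl !big_ord0 !mxE !(tnth_nth 0) /=; ring.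
Qed.

Lemma proportionalP (y z : 'rV[F]_4) :
  reflect (exists2 c : F, c != 0 & z = c *: y) (proportional y z).
Proof.
apply: (iffP existsP) => [[c /andP[c0 /eqP->]]|[c c0 ->]]; first by exists c.
by exists c; rewrite c0 eqxx.
Qed.

Lemma proportional_equiv : equivalence_rel (@proportional F).
Proof.
move=> x y z; split; first by apply/proportionalP; exists 1; rewrite ?oner_neq0 ?scale1r.
move/proportionalP=> [c c0 ->]; apply/proportionalP/proportionalP => -[d d0 ->].
  by exists (d / c); rewrite ?mulf_neq0 ?invr_eq0 // scalerA divfK.
by exists (d * c); rewrite ?mulf_neq0 // scalerA.
Qed.

(** The units act freely by scaling on the nonzero solutions, and the orbits are the
    points of the surface. *)
Lemma card_dwork_points :
  #|[set y | dwork_form u y == 0]| = (1 + #|F|.-1 * #|dwork_points u|)%N.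
Proof.
set D := [set y : 'rV[F]_4 | (y != 0) && (dwork_form u y == 0)].
have -> : [set y | dwork_form u y == 0] = 0 |: D.
  apply/setP => y; rewrite !inE; have [->|//] := eqVneq y 0.
  by rewrite -(scale0r (0 : 'rV_4)) dwork_form_scale expr0n mul0r eqxx.
rewrite cardsU1 !inE eqxx /=; congr (_ + _)%N; rewrite mulnC.
have equiv_D : {in D & &, equivalence_rel (@proportional F)}.
  by move=> x y z _ _ _; apply: proportional_equiv.
apply: card_uniform_partition (equivalence_partitionP equiv_D).
move=> _ /imsetP[x xD ->].
have -> : [set y in D | proportional x y] = [set c *: x | c in [pred c : F | c != 0]].
  apply/setP => y; rewrite [in LHS]inE; apply/andP/imsetP => [[_ /proportionalP[c c0 ->]]|[c c0 ->]].
    by exists c.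
  split; last by apply/proportionalP; exists c.
  move: xD c0; rewrite !inE => /andP[x0 /eqP fx] c0.
  by rewrite scaler_eq0 negb_or c0 x0 dwork_form_scale fx mulr0 eqxx.
rewrite card_in_imset ?card_units // => c d _ _ /eqP.
move: xD; rewrite inE => /andP[x0 _].
by rewrite -subr_eq0 -scalerBl scaler_eq0 (negPf x0) orbF subr_eq0 => /eqP.
Qed.

End PointCount.


(** * The hypergeometric sums and the theorem *)

Section Main.
Variables (R : realType) (F : finFieldType) (psi chi : F -> R[i]).
Hypothesis hpsi : nontrivial_additive_character psi.
Hypothesis hchi : multiplicative_character chi.
Hypothesis hord : character_order chi (#|F|).-1.
Let q := #|F|.

Let psi_neq0 : forall x, psi x != 0. Proof. by case: hpsi. Qed.
Let psiD : forall x y, psi (x + y) = psi x * psi y. Proof. by case: hpsi. Qed.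
Let psi_nt : exists x, psi x != 1. Proof. by case: hpsi. Qed.
Let chi_neq0 : forall x : F, x != 0 -> chi x != 0. Proof. by case: hchi. Qed.
Let chiM : forall x y : F, x != 0 -> y != 0 -> chi (x * y) = chi x * chi y.
Proof. by case: hchi. Qed.
Let chi_exp : forall x : F, x != 0 -> chi x ^+ q.-1 = 1. Proof. by case: hord. Qed.
Let chi_faithful : forall m : nat, (0 < m < q.-1)%N ->
  exists2 x : F, x != 0 & chi x ^+ m != 1.
Proof. by case: hord. Qed.
Let q1_gt0 : (0 < q.-1)%N. Proof. by case: hord. Qed.

Let gaussE m : gauss psi chi m = gsum psi chi m.
Proof. by []. Qed.

Lemma Fq_gammaE (G : gamma_triple) t : gt_N G = 1%N ->
  Fq_gamma psi chi G t =
  (1 - q%:R)^-1 * \sum_(m < q.-1) gamma_term psi chi (neg_part G) (pos_part G) t m.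
Proof.
move=> N1; rewrite /Fq_gamma -/q; congr (_ * _); apply: eq_bigr => m _.
have del0 j : (q.-1%:Z %| tnth (gt_delta G) j * (q.-1 %/ gt_N G)%N%:Z)%Z.
  by rewrite N1 divn1 dvdz_mull.
rewrite /gamma_term; congr (_ * _ * _ * _).
- transitivity (\prod_j gsum psi chi (- tnth (gt_gamma G) j * m%:Z)).
    apply: eq_bigr => j _; rewrite gaussE.
    by apply: gsum_eqmod => //; rewrite addrAC subrr add0r.
  rewrite (prod_gamma G (fun c => gsum psi chi (- c * m%:Z))).
  by congr (_ * _); apply: eq_bigr => a _; congr gsum; rewrite ?opprK // mulNr.
- congr (_ ^-1).
  transitivity (\prod_(j < (gt_dim G).+2) (-1 : R[i])).
    apply: eq_bigr => j _; rewrite gaussE (@gsum_eqmod _ _ _ _ _ _ _ 0) ?subr0 //.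
    by rewrite gsum0.
  rewrite (prod_gamma G (fun _ => -1)) exprD.
  by congr (_ * _); rewrite big_const_seq count_predT; elim: (size _) => //= n ->; rewrite exprS.
- congr (_ ^ (_ - _)); first by rewrite s_deltaE.
  by rewrite -[0 in LHS]oppr0 (s_deltaE _ _ 0).
congr (chi (_ * t) ^+ m).
rewrite (prod_gamma G (fun c : int => (c%:~R : F) ^ c)).
by congr (_ * _); apply: eq_bigr => a _; rewrite mulrNz -exprnN.
Qed.


Let natF_neq0 (s : seq nat) := all (fun a => a%:R != 0 :> F) s.

Lemma gamma_term_cancel_cat s N P t k :
  natF_neq0 s -> natF_neq0 N -> natF_neq0 P -> t != 0 ->
  gamma_term psi chi (s ++ N) (s ++ P) t k = gamma_term psi chi N P t k.
Proof.
move=> s0 N0 P0 t0; have prod0 u : natF_neq0 u -> \prod_(b <- u) b%:R != 0 :> F.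
  by move=> /allP u0; rewrite prodf_seq_neq0; apply/allP => b /u0.
elim: s s0 => [//|a s IHs] /= /andP[a0 s0]; rewrite -[RHS]IHs //.
by apply: gamma_term_cancel => //; apply: prod0; rewrite /natF_neq0 all_cat; apply/andP.
Qed.

Lemma natF_parts G : defined_at G q ->
  natF_neq0 (neg_part G) && natF_neq0 (pos_part G).
Proof.
case/andP => /forallP cop _.
by apply/andP; split; apply/allP => a /mapP[j _ ->]; apply: natr_coprime_neq0.
Qed.

(** Comparing the two representations of the parameters gives
    cyclo_prod (A ++ pos_part G) = cyclo_prod (neg_part G ++ B), hence equal
    multisets; then (neg_part G, pos_part G) and (A, B) become equal after B and
    pos_part G are added to both of their members. *)
Lemma Fq_gamma_represents n (P : hyp_param n) (G : gamma_triple) A B t :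
  gt_N G = 1%N -> represents_at R F P G -> t != 0 ->
  all (leq 1) A -> all (leq 1) B -> natF_neq0 A -> natF_neq0 B ->
  (\prod_j ('X - (expi2pi R (tnth (hp_alpha P) j))%:P)) * cyclo_prod R B =
  cyclo_prod R A * \prod_j ('X - (expi2pi R (tnth (hp_beta P) j))%:P) ->
  Fq_gamma psi chi G t =
  (1 - q%:R)^-1 * \sum_(m < q.-1) gamma_term psi chi A B t m.
Proof.
move=> N1 [repG defG] t0 A1 B1 A0 B0 repAB.
rewrite Fq_gammaE //; congr (_ * _); apply: eq_bigr => m _.
have /andP[neg0 pos0] := natF_parts defG.
have perm : perm_eq (A ++ pos_part G) (neg_part G ++ B).
  apply: (@perm_eq_cyclo_prod R).
  - by rewrite all_cat A1 pos_part_gt0.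
  - by rewrite all_cat B1 neg_part_gt0.
  have b0 : \prod_j ('X - (expi2pi R (tnth (hp_beta P) j))%:P) != 0.
    by apply/prodf_neq0 => j _; rewrite polyXsubC_eq0.
  move/(representsE R N1): repG => repG.
  rewrite /cyclo_prod !big_cat /= -!/(cyclo_prod R _).
  apply: (mulIf b0); rewrite [LHS]mulrAC -repAB [LHS]mulrAC repG; ring.
rewrite -(gamma_term_cancel_cat m B0) // -[RHS](gamma_term_cancel_cat m pos0) //.
apply: gamma_term_perm; last by rewrite perm_catC.
by rewrite perm_catC -(permPl perm) perm_catC.
Qed.

(** The triple G0 shows that the minimal N is 1, and all triples with N = 1 have the
    same sum. *)
Lemma Fq_nonintegral n (P : hyp_param n) (G0 : gamma_triple) A B t :
  ~~ integral_at F P -> gt_N G0 = 1%N -> represents_at R F P G0 -> t != 0 ->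
  all (leq 1) A -> all (leq 1) B -> natF_neq0 A -> natF_neq0 B ->
  (\prod_j ('X - (expi2pi R (tnth (hp_alpha P) j))%:P)) * cyclo_prod R B =
  cyclo_prod R A * \prod_j ('X - (expi2pi R (tnth (hp_beta P) j))%:P) ->
  Fq psi chi P t = (1 - q%:R)^-1 * \sum_(m < q.-1) gamma_term psi chi A B t m.
Proof.
move=> nint N01 repG0 t0 A1 B1 A0 B0 repAB; rewrite /Fq (negPf nint).
case: xgetP => [v _ [G [repG minG ->]]|noG].
  apply: (@Fq_gamma_represents n P) => //.
  by apply/eqP; rewrite eqn_leq gt_N_gt0 andbT -N01 minG.
case: (noG (Fq_gamma psi chi G0 t)); exists G0; split => // G' _.
by rewrite N01 gt_N_gt0.
Qed.

(** The affine zeros are the origin and the q - 1 representatives of each point. *)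
Let point_sum u : q%:R * (1 + q.-1%:R * #|dwork_points u|%:R) = q%:R ^+ 4 +
   \sum_(a | a != 0) ((1 + quartic_sum psi chi 0 a) ^+ 4 - quartic_sum psi chi 0 a ^+ 4
      + dwork_torus_sum psi (- (4 * u^-1)) a) :> R[i].
Proof.
rewrite -(card_dwork_affine chi psiD psi_neq0 psi_nt (dwork_form_row4 u)).
by rewrite card_dwork_points natrD natrM.
Qed.

Let scaledE (x : rat) (n : nat) : x * q.-1%:R = n%:R -> scaled F x = n%:Z.
Proof. by move=> xE; rewrite /scaled xE (pmulrn _ n) intrKfloor. Qed.

Let isint (x : rat) := x * q.-1%:R \is a Num.int.

Lemma integral_at1 a1 b1 d : isint a1 -> isint b1 ->
  integral_at F (@HypParam 1 [tuple a1] [tuple b1] d).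
Proof. by rewrite /integral_at /= !andbT /isint => -> ->. Qed.

Lemma integral_at2 a1 a2 b1 b2 d : isint a1 -> isint a2 -> isint b1 -> isint b2 ->
  integral_at F (@HypParam 2 [tuple a1; a2] [tuple b1; b2] d).
Proof. by rewrite /integral_at /= !andbT /isint => -> -> -> ->. Qed.

Lemma integral_at3 a1 a2 a3 b1 b2 b3 d :
  isint a1 -> isint a2 -> isint a3 -> isint b1 -> isint b2 -> isint b3 ->
  integral_at F (@HypParam 3 [tuple a1; a2; a3] [tuple b1; b2; b3] d).
Proof. by rewrite /integral_at /= !andbT /isint => -> -> -> -> -> ->. Qed.

Lemma nonintegral_at (n : nat) (P : hyp_param n) x :
  x \in hp_alpha P -> ~~ isint x -> ~~ integral_at F P.
Proof. by move=> xP; apply: contra => /andP[/allP /(_ x xP)]. Qed.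

Section ThreeModFour.
Hypothesis q3 : (q %% 4 = 3)%N.
Let h := q.-1./2.

Let h_odd : odd h. Proof. rewrite /h; lia. Qed.
Let q1E : q.-1 = (2 * h)%N. Proof. rewrite /h; lia. Qed.

Let two_F : 2 != 0 :> F := two_neq0 q1E.
Let four_F : 4 != 0 :> F.
Proof. by rewrite (natrM _ 2 2) mulf_neq0. Qed.

Let nint_quarter : 1 / 4 * q.-1%:R \isn't a (@Num.int rat).
Proof.
apply/negP => /intrP[n] hn.
have : (q.-1%:Z)%:~R = (n * 4)%:~R :> rat.
  by rewrite intrM -hn -pmulrn; field.
by move/eqP; rewrite eqr_int => /eqP; move: q1E h_odd; lia.
Qed.

Let coprime_q (k : nat) : k \in [:: 1; 2; 4]%N -> coprime q k.
Proof.
have odd_q : odd q by lia.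
have c2 : coprime q 2 by rewrite coprimen2.
rewrite !inE => /or3P[] /eqP->; rewrite ?coprimen1 //.
by rewrite (coprimeMr _ 2 2) c2.
Qed.

Lemma dwork_three_mod_four u : u != 0 ->
  #|dwork_points u|%:R = (q ^ 2 + q + 1)%N%:R + Fq psi chi quartic_params (u ^+ 4)
    - 3 * q%:R * Fq psi chi quadratic_params (u ^+ 4).
Proof.
move=> u0; have u40 : u ^+ 4 != 0 by rewrite expf_neq0.
rewrite (@Fq_nonintegral _ quartic_params quartic_triple [:: 4%N] [:: 1; 1; 1; 1]%N) //.
rewrite (@Fq_nonintegral _ quadratic_params quadratic_triple [:: 4%N] [:: 2; 2]%N) //.
rewrite !natrD natrX.
exact: (dwork_identity_odd_half psiD psi_neq0 psi_nt chi_neq0 chiM chi_exp chi_faithful q1E h_odd u0 (point_sum u)).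
- by apply: (nonintegral_at (x := 1 / 4)); [exact: mem_head | exact: nint_quarter].
- split; first (apply/representsE => //).
    rewrite cyclo_prod_quadratic_neg cyclo_prod_quadratic_pos quadratic_betaE.
    rewrite -(quadratic_alphaE R); ring.
  apply/andP; split; last exact: dvd1n.
  by apply/forallP=> -[[|[|[|[|[|//]]]]] ?]; apply: coprime_q.
- by rewrite /= four_F.
- by rewrite /= two_F.
- rewrite /cyclo_prod !big_cons !big_nil quadratic_betaE -(quadratic_alphaE R); ring.
- by apply: (nonintegral_at (x := 1 / 4)); [exact: mem_head | exact: nint_quarter].
- split; first (apply/representsE => //).
    rewrite cyclo_prod_quartic_neg cyclo_prod_quartic_pos quartic_betaE.
    rewrite -(quartic_alphaE R); ring.
  apply/andP; split; last exact: dvd1n.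
  by apply/forallP=> -[[|[|[|[|[|//]]]]] ?]; apply: coprime_q.
- by rewrite /= four_F.
- by rewrite /= oner_neq0.
- rewrite /cyclo_prod !big_cons !big_nil quartic_betaE -(quartic_alphaE R) expr1; ring.
Qed.

End ThreeModFour.

Section OneModFour.
Hypothesis q1mod : (q %% 4 = 1)%N.
Let p := (q.-1 %/ 4)%N.

Let q1E : q.-1 = (4 * p)%N. Proof. rewrite /p; lia. Qed.

Let q1Q : q.-1%:R = 4 * p%:R :> rat. Proof. by rewrite q1E natrM. Qed.

Let scaled1 : scaled F 1 = q.-1%:Z. Proof. by apply: scaledE; rewrite mul1r. Qed.
Let scaled14 : scaled F (1 / 4) = p%:Z.
Proof. by apply: scaledE; rewrite q1Q; field. Qed.
Let scaled24 : scaled F (2 / 4) = 2 * p%:Z.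
Proof. by rewrite (scaledE (n := 2 * p)) // q1Q natrM; field. Qed.
Let scaled12 : scaled F (1 / 2) = 2 * p%:Z.
Proof. by rewrite (scaledE (n := 2 * p)) // q1Q natrM; field. Qed.
Let scaled34 : scaled F (3 / 4) = 3 * p%:Z.
Proof. by rewrite (scaledE (n := 3 * p)) // q1Q natrM; field. Qed.

Let int1 : (1 : rat) * q.-1%:R \is a Num.int.
Proof. by rewrite mul1r natr_int. Qed.
Let int14 : 1 / 4 * q.-1%:R \is a (@Num.int rat).
Proof. by rewrite (_ : _ * _ = p%:R) ?natr_int // q1Q; field. Qed.
Let int24 : 2 / 4 * q.-1%:R \is a (@Num.int rat).
Proof. by rewrite (_ : _ * _ = (2 * p)%:R) ?natr_int // q1Q natrM; field. Qed.
Let int12 : 1 / 2 * q.-1%:R \is a (@Num.int rat).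
Proof. by rewrite (_ : _ * _ = (2 * p)%:R) ?natr_int // q1Q natrM; field. Qed.
Let int34 : 3 / 4 * q.-1%:R \is a (@Num.int rat).
Proof. by rewrite (_ : _ * _ = (3 * p)%:R) ?natr_int // q1Q natrM; field. Qed.

Let hyp_termE n (P : hyp_param n) (ab : seq (int * int)) t : integral_at F P ->
  ab = [seq (scaled F x.1, scaled F x.2) | x <- zip (hp_alpha P) (hp_beta P)] ->
  Fq psi chi P t = (1 - q%:R)^-1 * \sum_(m < q.-1) hyp_term psi chi ab t m.
Proof.
move=> intP ->; rewrite /Fq intP; congr (_ * _); apply: eq_bigr => m _.
rewrite /hyp_term size_map size_zip !size_tuple minnn; congr (_ * _).
rewrite big_map (big_nth (0, 0)) size_zip !size_tuple minnn big_mkord.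
apply: eq_bigr => i _; rewrite nth_zip; last by rewrite !size_tuple.
by rewrite !(tnth_nth 0).
Qed.

Lemma dwork_one_mod_four u : u != 0 ->
  #|dwork_points u|%:R = (q ^ 2 + q + 1)%N%:R + Fq psi chi quartic_params (u ^+ 4)
    + 3 * q%:R * Fq psi chi quadratic_params (u ^+ 4)
    + 12 * chi (-1) ^+ ((q - 1) %/ 4) * q%:R * Fq psi chi linear_params (u ^+ 4).
Proof.
move=> u0.
rewrite (@hyp_termE _ quartic_params [:: (p%:Z, q.-1%:Z); (2 * p%:Z, q.-1%:Z); (3 * p%:Z, q.-1%:Z)]).
- rewrite (@hyp_termE _ quadratic_params [:: (p%:Z, 2 * p%:Z); (3 * p%:Z, q.-1%:Z)]).
  + rewrite (@hyp_termE _ linear_params [:: (2 * p%:Z, q.-1%:Z)]).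
    * rewrite !natrD natrX subn1.
      exact: (dwork_identity_quarter psiD psi_neq0 psi_nt chi_neq0 chiM chi_exp chi_faithful q1E u0 (point_sum u)).
    * exact: integral_at1 int12 int1.
    * by rewrite /= scaled12 scaled1.
  + exact: integral_at2 int14 int34 int12 int1.
  + by rewrite /= scaled14 scaled34 scaled12 scaled1.
- exact: integral_at3 int14 int24 int34 int1 int1 int1.
- by rewrite /= scaled14 scaled24 scaled34 scaled1.
Qed.

End OneModFour.

End Main.


Theorem theorem1p11 (R : realType) (F : finFieldType) (psi chi : F -> R[i])
    (hpsi : nontrivial_additive_character psi)
    (hchi : multiplicative_character chi)
    (hord : character_order chi (#|F|).-1)
    (u : F) (hu : u != 0) :
  let q := #|F| in
  let F1 := Fq psi chi (@HypParam 3 [tuple 1 / 4; 2 / 4; 3 / 4] [tuple 1; 1; 1] isT) in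
  let F2 := Fq psi chi (@HypParam 2 [tuple 1 / 4; 3 / 4] [tuple 1 / 2; 1] isT) in
  let F3 := Fq psi chi (@HypParam 1 [tuple 1 / 2] [tuple 1] isT) in
  ((q %% 4 = 3)%N ->
     #|dwork_points u|%:R
     = (q ^ 2 + q + 1)%N%:R + F1 (u ^+ 4) - 3 * q%:R * F2 (u ^+ 4))
  /\
  ((q %% 4 = 1)%N ->
     #|dwork_points u|%:R
     = (q ^ 2 + q + 1)%N%:R + F1 (u ^+ 4) + 3 * q%:R * F2 (u ^+ 4)
       + 12 * chi (-1) ^+ ((q - 1) %/ 4) * q%:R * F3 (u ^+ 4)).
Proof.
move=> q F1 F2 F3; split=> q_mod.
  exact: dwork_three_mod_four.
exact: dwork_one_mod_four.
Qed.
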